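(* Let $K$ be a discrete valuation field of characteristic $p>0$ and let $\varphi\in W_n(K)$. Then $$s_K(\varphi)=\sup\{e(K'/K)^{-1}s_{K'}(\varphi)\mid K'\in\mathcal{E}_1\},$$ where $\mathcal{E}_1$ is the class of discrete valuation fields $K'\supset K$ with $O_{K'}\cap K=O_K$, $m_{K'}\cap K=m_K$, and perfect residue field, and $e(K'/K)$ is the ramification index.
   Context: For a discrete valuation field $L$ of characteristic $p$ with normalized valuation $v_L$: $\mathrm{fil}_mW_n(L)=\{(f_{n-1},\dots,f_0)\mid p^jv_L(f_j)\ge-m\ \forall j\}$, $F$ the componentwise $p$-th power, $\mathrm{fil}^F_mW_n(L)=\sum_{j\ge0}F^j(\mathrm{fil}_mW_n(L))$, $s_L(\varphi)=\min\{m\in\mathbb{N}\mid\varphi\in\mathrm{fil}^F_mW_n(L)\}$. *)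

(* Defs.v *)
From HB Require Import structures.
From mathcomp Require Import all_boot all_order all_algebra.
From mathcomp Require Import mpoly.
From Stdlib Require Import ClassicalEpsilon.

Set Implicit Arguments.
Unset Strict Implicit.
Unset Printing Implicit Defensive.

Import Order.TTheory GRing.Theory Num.Theory.
Local Open Scope ring_scope.

(* Discrete valuations.  A valuation is a map v : L -> int whose value *)
(* at 0 is irrelevant (morally v 0 = +oo); all axioms only concern     *)
(* nonzero elements.  "Normalized" = some element has valuation 1.     *)
Definition is_dvaluation (L : fieldType) (v : L -> int) : Prop :=
  [/\ forall x y : L, x != 0 -> y != 0 -> v (x * y) = v x + v y,
      forall x y : L, x != 0 -> y != 0 -> x + y != 0 ->
        Num.min (v x) (v y) <= v (x + y)
    & exists x : L, x != 0 /\ v x = 1].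

(* valge v x k  <=>  v(x) >= k, with the convention v(0) = +oo. *)
Definition valge (L : fieldType) (v : L -> int) (x : L) (k : int) : bool :=
  (x == 0) || (k <= v x).

(* Witt vectors of length n.  A Witt vector is stored in the standard  *)
(* order a = (a_0, ..., a_{n-1}) (ghost components                     *)
(*   w_k = sum_{i<=k} p^i a_i^(p^(k-i))).                              *)
(* The paper writes it as (f_{n-1}, ..., f_0), i.e. a_i = f_{n-1-i}.   *)
Definition witt (L : Type) (n : nat) := {ffun 'I_n -> L}.

Section WittPolys.
Variables (p n : nat).

Definition wX (i : 'I_n) : {mpoly int[n + n]} := 'X_(lshift n i).
Definition wY (i : 'I_n) : {mpoly int[n + n]} := 'X_(rshift n i).

Definition ghostX (k : nat) : {mpoly int[n + n]} :=
  \sum_(i < n | (i <= k)%N) (wX i ^+ (p ^ (k - i))) *+ (p ^ i).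
Definition ghostY (k : nat) : {mpoly int[n + n]} :=
  \sum_(i < n | (i <= k)%N) (wY i ^+ (p ^ (k - i))) *+ (p ^ i).

Definition mdivz (q : {mpoly int[n + n]}) (d : int) : {mpoly int[n + n]} :=
  \sum_(m <- msupp q) (q@_m %/ d)%Z *: 'X_[m].

(* The list [:: S_0; ...; S_k] of Witt addition polynomials:           *)
(*   p^k S_k = w_k(X) + w_k(Y) - sum_{i<k} p^i S_i^(p^(k-i)).          *)
Fixpoint wittS_seq (k : nat) : seq {mpoly int[n + n]} :=
  match k with
  | 0 => [:: ghostX 0 + ghostY 0]
  | k'.+1 =>
      let s := wittS_seq k' in
      rcons s (mdivz (ghostX k + ghostY k
                      - \sum_(i < k) (s`_i ^+ (p ^ (k - i))) *+ (p ^ i))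
                     (p ^ k)%:Z)
  end.

Definition wittS (k : nat) : {mpoly int[n + n]} := (wittS_seq k)`_k.

End WittPolys.

Section WittOps.
Variables (L : fieldType) (p n : nat).

Definition wadd (a b : witt L n) : witt L n :=
  [ffun k : 'I_n =>
     mmap (fun z : int => z%:~R)
          (fun j : 'I_(n + n) =>
             match split j with inl i => a i | inr i => b i end)
          (wittS p n k)].

Definition wzero : witt L n := [ffun _ => 0].

Definition wfrob (a : witt L n) : witt L n := [ffun i => a i ^+ p].

(* fil_m W_n(L) = {(f_{n-1},...,f_0) | p^j v(f_j) >= -m}; with           *)
(* a_i = f_{n-1-i} this reads p^(n-1-i) v(a_i) >= -m.                    *)
Definition in_fil (v : L -> int) (m : nat) (a : witt L n) : Prop :=
  forall i : 'I_n, (a i == 0) || (- (m%:Z) <= (p ^ (n.-1 - i))%:Z * v (a i)).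

(* fil^F_m W_n(L) = sum_{j>=0} F^j(fil_m W_n(L)) (sum of subgroups of   *)
(* the additive group W_n(L)), i.e. the set of finite sums              *)
(* sum_{j<J} F^j(x_j) with all x_j in fil_m W_n(L).                     *)
Definition in_filF (v : L -> int) (m : nat) (a : witt L n) : Prop :=
  exists (J : nat) (x : nat -> witt L n),
    (forall j, in_fil v m (x j)) /\
    a = foldr wadd wzero [seq iter j wfrob (x j) | j <- iota 0 J].

Definition decP (P : Prop) : bool :=
  if excluded_middle_informative P then true else false.

(* s_L(a) = min {m in N | a in fil^F_m W_n(L)} (0 if no such m, which   *)
(* does not happen).                                                    *)
Definition swan (v : L -> int) (a : witt L n) : nat :=
  match excluded_middle_informative
          (exists m, decP (in_filF v m a)) with
  | left H => ex_minn H
  | right _ => 0%N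
  end.

End WittOps.

Definition wmap (K K' : fieldType) (f : K -> K') (n : nat) (a : witt K n)
  : witt K' n := [ffun i => f (a i)].

(* The class E_1 relative to (K, v): (K', iota, v') with iota : K -> K'  *)
(* a field embedding, v' a normalized discrete valuation on K' with      *)
(* O_{K'} cap K = O_K, m_{K'} cap K = m_K, and perfect residue field of  *)
(* characteristic p.                                                     *)
Definition in_E1 (p : nat) (K : fieldType) (v : K -> int)
  (K' : fieldType) (iota : {rmorphism K -> K'}) (v' : K' -> int) : Prop :=
  [/\ is_dvaluation v',
      forall x : K, valge v' (iota x) 0 = valge v x 0,
      forall x : K, valge v' (iota x) 1 = valge v x 1
    & forall a : K', valge v' a 0 ->
        exists b : K', valge v' b 0 /\ valge v' (a - b ^+ p) 1].

(* Main.v *)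
(* Base change gives e^-1 s_K'(phi) <= s_K(phi).  Conversely let s_K(phi) = m > 0.
   Writing phi = x_0 + F(x_1) + F^2(x_2) + ... with x_j in fil_m, and using that F(psi) in fil^F_m implies psi in fil^F_m, one
   may focus on the first x = x_j outside fil^F_(m-1).  Let f = x_k be its first
   component that is not congruent to a p-th power modulo higher valuation.
   Comparing Witt components up to index k, x in fil^F_m' over K' forces
   p^(n-1-k) v'(f - h^p) >= -m' for some h in K'.

   It remains to choose K' such that f is far from p-th powers.  All K' are maximal
   among the subfields of the perfect closure of K with value group (1/e)Z:
   maximality makes the residue field perfect, because adjoining a p-th root of a
   unit whose residue is not a p-th power does not enlarge the value group.  If p
   does not divide v(f), take e = 1.  If it does, write f = a s^p with a a unit and
   take K' containing u = t^(1/e), for e = p^N, and a p-th root of a - u: then f is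
   a p-th power plus u s^p, of valuation e v(f) + 1 prime to p.  This gives
   s_K'(phi) >= e m - p^(n-1-k), and N is arbitrary. *)

(* The obstacle is that over a perfect residue field every unit is a p-th power modulo the maximal
   ideal. When p divides v(f), the leading term of f is therefore lost over K', and only a remainder
   of larger valuation can bound s_K' from below. The remainder u s^p exceeds v'(f) by the least
   possible amount 1. Its cost p^(n-1-k) does not grow with e, so it disappears after division by e.

   Replacing a by a - u does not change its residue class, which is not a p-th power. Hence a p-th
   root of a - u can be adjoined without enlarging (1/e)Z, before passing to a maximal field.

   The index k is minimal because Witt addition has carries. Below k the leading terms are p-th
   powers and are removed by subtracting some F(g). As the addition polynomials are isobaric, this
   changes component k only by terms of valuation above the critical one. *)
Require Import Defs.
From HB Require Import structures.
From mathcomp Require Import all_boot all_order all_algebra.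
From mathcomp Require Import mpoly generic_quotient zify.
From mathcomp Require classical_sets.
Import Order.TTheory GRing.Theory Num.Theory.
Local Open Scope ring_scope.
Local Open Scope quotient_scope.

Set Implicit Arguments.
Unset Strict Implicit.
Unset Printing Implicit Defensive.

(** * Congruences modulo integers in a ring *)

Section Congruences.
Variable R : comNzRingType.
Implicit Types (d k p : nat) (x y z : R).

Definition congr_mod d x y : Prop := exists c : R, x = y + c *+ d.

Lemma congr_mod_refl d x : congr_mod d x x.
Proof. by exists 0; rewrite mul0rn addr0. Qed.

Lemma congr_mod_sym d x y : congr_mod d x y -> congr_mod d y x.
Proof. by case=> c ->; exists (- c); rewrite mulNrn addrK. Qed.

Lemma congr_mod_trans d y x z :
  congr_mod d x y -> congr_mod d y z -> congr_mod d x z.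
Proof. by case=> c -> [c' ->]; exists (c' + c); rewrite mulrnDl addrA. Qed.

Lemma congr_modD d x y x' y' :
  congr_mod d x y -> congr_mod d x' y' -> congr_mod d (x + x') (y + y').
Proof. by case=> c -> [c' ->]; exists (c + c'); rewrite mulrnDl addrACA. Qed.

Lemma congr_modN d x y : congr_mod d x y -> congr_mod d (- x) (- y).
Proof. by case=> c ->; exists (- c); rewrite mulNrn opprD. Qed.

Lemma congr_modM d x y x' y' :
  congr_mod d x y -> congr_mod d x' y' -> congr_mod d (x * x') (y * y').
Proof.
case=> c -> [c' ->]; exists (y * c' + c * y' + (c * c') *+ d).
rewrite mulrDl !mulrDr !mulrnAl !mulrnAr !mulrnDl !addrA.
by congr (_ + _); rewrite -!addrA.
Qed.

Lemma congr_modX d x y k : congr_mod d x y -> congr_mod d (x ^+ k) (y ^+ k).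
Proof.
move=> cxy; elim: k => [|k IH]; first exact: congr_mod_refl.
by rewrite !exprS; apply: congr_modM.
Qed.

Lemma congr_mod_sum d (I : Type) (r : seq I) (P : pred I) (F G : I -> R) :
  (forall i, P i -> congr_mod d (F i) (G i)) ->
  congr_mod d (\sum_(i <- r | P i) F i) (\sum_(i <- r | P i) G i).
Proof.
move=> FG; apply: (big_ind2 (congr_mod d)) => //; first exact: congr_mod_refl.
by move=> *; apply: congr_modD.
Qed.

Lemma congr_modMn d k x y : congr_mod d x y -> congr_mod (k * d) (x *+ k) (y *+ k).
Proof. by case=> c ->; exists c; rewrite mulrnDl -mulrnA mulnC. Qed.

Lemma congr_mod_dvd d k x y : (d %| k)%N -> congr_mod k x y -> congr_mod d x y.
Proof.
by case/dvdnP=> q -> [c ->]; exists (c *+ q); rewrite -mulrnA.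
Qed.

(** Factor x^p - y^p as (x - y) times a sum of p terms, each congruent to y^(p-1) modulo p. The sum
    supplies the extra factor p. *)
Lemma congr_mod_lift p k x y :
  congr_mod (p ^ k.+1) x y -> congr_mod (p ^ k.+2) (x ^+ p) (y ^+ p).
Proof.
move=> cxy; have [c Ex] := cxy.
have [d Ed] : congr_mod p (\sum_(i < p) x ^+ (p.-1 - i) * y ^+ i) 0.
  apply: (@congr_mod_trans _ (\sum_(i < p) y ^+ p.-1)).
    apply: congr_mod_sum => i _.
    rewrite -[in X in congr_mod _ _ X](subnK (_ : i <= p.-1)%N); last first.
      by rewrite -ltnS (ltn_predK (ltn_ord i)).
    rewrite exprD; apply: congr_modM; last exact: congr_mod_refl.
    apply: congr_modX; apply: congr_mod_dvd cxy; exact: dvdn_exp.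
  by exists (y ^+ p.-1); rewrite add0r sumr_const card_ord.
exists (c * d); have := subrXX x y p.
have -> : x - y = c *+ p ^ k.+1 by rewrite Ex addrAC subrr add0r.
rewrite Ed add0r mulrnAl mulrnAr -mulrnA -expnS => E.
by rewrite addrC -E subrK.
Qed.

Lemma congr_mod_expX p k x y :
  congr_mod p x y -> congr_mod (p ^ k.+1) (x ^+ (p ^ k)) (y ^+ (p ^ k)).
Proof.
move=> cxy; elim: k => [|k IH]; first by rewrite expn0 expn1 !expr1.
have E z : z ^+ (p ^ k.+1) = (z ^+ (p ^ k)) ^+ p by rewrite expnSr exprM.
by rewrite !E; apply: congr_mod_lift.
Qed.

Lemma congr_mod_exprD p x y :
  prime p -> congr_mod p ((x + y) ^+ p) (x ^+ p + y ^+ p).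
Proof.
move=> p_pr; rewrite exprDn.
case: p p_pr => // p p_pr.
rewrite big_ord_recl big_ord_recr /= subn0 expr0 mulr1 bin0 mulr1n.
rewrite /bump /= add1n subnn expr0 mul1r binn mulr1n.
rewrite addrCA addrC; set s := \sum_(_ < _) _.
have [c ->] : congr_mod p.+1 s 0.
  rewrite /s; apply: (big_ind (congr_mod p.+1 ^~ 0)) => [|z z' cz cz'|i _].
  - exact: congr_mod_refl.
  - by rewrite -[0]addr0; apply: congr_modD.
  rewrite add1n.
  have /dvdnP[q ->] : (p.+1 %| 'C(p.+1, i.+1))%N.
    by apply: prime_dvd_bin => //=; rewrite ltnS.
  by rewrite mulrnA; exists (x ^+ (p.+1 - i.+1) * y ^+ i.+1 *+ q); rewrite add0r.
by exists c; rewrite add0r.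
Qed.

Lemma congr_mod_fermat p (c : int) :
  prime p -> congr_mod p ((c%:~R : R) ^+ p) c%:~R.
Proof.
move=> p_pr.
have pos (m : nat) : congr_mod p ((m%:R : R) ^+ p) m%:R.
  elim: m => [|m IH].
    by rewrite expr0n eqn0Ngt prime_gt0 //; apply: congr_mod_refl.
  rewrite -addn1 natrD; apply: congr_mod_trans (congr_mod_exprD _ _ p_pr) _.
  by apply: congr_modD => //; rewrite expr1n; apply: congr_mod_refl.
case: c => m; first exact: pos.
rewrite NegzE mulrNz -[m.+1%:~R]/(m.+1%:R : R).
(* Additivity modulo p applied to -(m+1) + (m+1) = 0 gives the negative case without discussing the
   parity of p. *)
have := congr_modD (congr_mod_sym (congr_mod_exprD (- m.+1%:R) m.+1%:R p_pr))
                   (congr_modN (pos m.+1)).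
by rewrite addNr expr0n eqn0Ngt prime_gt0 //= add0r addrK.
Qed.
End Congruences.

(** * Integrality of the Witt addition polynomials *)

(** The evaluation that occurs inside [wadd], over any commutative ring: polynomial rings will give
    torsion-freeness, and a product ring will compare two sums. *)
Definition zeval (N : nat) (R : comNzRingType) (h : 'I_N -> R)
    (q : {mpoly int[N]}) : R :=
  mmap (fun z : int => z%:~R) h q.

Section Zeval.
Variables (N : nat) (R : comNzRingType) (h : 'I_N -> R).

Lemma zeval_is_zmod_morphism : zmod_morphism (zeval h).
Proof. exact: (mmap_is_additive h (intmul 1 : {rmorphism int -> R})). Qed.
HB.instance Definition _ :=
  GRing.isZmodMorphism.Build {mpoly int[N]} R (zeval h) zeval_is_zmod_morphism.

Lemma zeval_is_monoid_morphism : monoid_morphism (zeval h).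
Proof.
by have [hM h1] := mmap_is_multiplicative h (intmul 1 : {rmorphism int -> R}).
Qed.
HB.instance Definition _ :=
  GRing.isMonoidMorphism.Build {mpoly int[N]} R (zeval h) zeval_is_monoid_morphism.

Lemma zevalXm m : zeval h 'X_[m] = mmap1 h m.
Proof. exact: (mmapX h (intmul 1 : {rmorphism int -> R})). Qed.

Lemma zevalX i : zeval h 'X_i = h i.
Proof. by rewrite zevalXm mmap1U. Qed.

Lemma zevalC c : zeval h c%:MP = c%:~R.
Proof. exact: (mmapC h (intmul 1 : {rmorphism int -> R})). Qed.

End Zeval.

Lemma eq_zeval (N : nat) (R : comNzRingType) (h h' : 'I_N -> R) q :
  h =1 h' -> zeval h q = zeval h' q.
Proof.
by move=> hh'; apply: eq_bigr => m _; congr (_ * _); apply: mmap1_eq.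
Qed.

Lemma rmorph_zeval (N : nat) (R S : comNzRingType) (f : {rmorphism R -> S})
    (h : 'I_N -> R) q :
  f (zeval h q) = zeval (f \o h) q.
Proof.
rewrite /zeval /mmap rmorph_sum; apply: eq_bigr => m _.
rewrite rmorphM rmorph_int rmorph_prod; congr (_ * _).
by apply: eq_bigr => i _; rewrite rmorphXn.
Qed.

(** The substitution of X_i^p for X_i agrees with the p-th power exactly on monomials, and modulo p
    on coefficients by Fermat; additivity modulo p does the rest. *)
Lemma zeval_frobenius (p N : nat) (q : {mpoly int[N]}) : prime p ->
  congr_mod p (zeval (fun i => 'X_i ^+ p) q : {mpoly int[N]}) (q ^+ p).
Proof.
move=> p_pr; elim/mpolyind: q => [|c m q _ _ IH].
  by rewrite rmorph0 expr0n eqn0Ngt prime_gt0 //; apply: congr_mod_refl.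
rewrite rmorphD; apply: congr_mod_trans (congr_mod_sym (congr_mod_exprD _ _ p_pr)).
apply: congr_modD IH; rewrite -mul_mpolyC rmorphM exprMn /=.
have -> : zeval (fun i => 'X_i ^+ p) 'X_[m] = ('X_[m] : {mpoly int[N]}) ^+ p.
  rewrite zevalXm -(mmap1_id int m) /mmap1 -prodrXl; apply: eq_bigr => i _.
  by rewrite exprAC.
apply: congr_modM; last exact: congr_mod_refl.
rewrite zevalC.
have -> : c%:MP = c%:~R :> {mpoly int[N]}.
  by rewrite -[c in LHS]intz rmorph_int.
exact/congr_mod_sym/congr_mod_fermat.
Qed.

Section WittPolynomials.
Variables (p n : nat).
Hypothesis p_pr : prime p.

Let p_gt0 : (0 < p)%N := prime_gt0 p_pr.

(** [mdivz] rounds each coefficient, so the recursion for the addition polynomials is meaningful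
    only once the dividend is known to be an exact multiple. *)
Lemma mdivzMn (c : {mpoly int[n + n]}) (d : nat) :
  (0 < d)%N -> mdivz (c *+ d) d%:Z = c.
Proof.
move=> d_gt0; rewrite /mdivz [RHS]mpolyE.
have dE m : ((c *+ d)@_m %/ d%:Z)%Z = c@_m.
  by rewrite mcoeffMn -mulr_natr natz mulzK // -lt0n.
rewrite (perm_big (msupp c)) /=; first by apply: eq_bigr => m _; rewrite dE.
apply: uniq_perm (msupp_uniq _) (msupp_uniq _) _ => m.
by rewrite !mcoeff_msupp mcoeffMn mulrn_eq0 eqn0Ngt d_gt0.
Qed.

Lemma size_wittS_seq k : size (wittS_seq p n k) = k.+1.
Proof. by elim: k => //= k IH; rewrite size_rcons IH. Qed.

Lemma nth_wittS_seq k i : (i <= k)%N -> (wittS_seq p n k)`_i = wittS p n i.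
Proof.
elim: k i => [|k IH] i; first by rewrite leqn0 => /eqP->.
rewrite leq_eqVlt ltnS => /predU1P[->//|le_ik].
by rewrite /= nth_rcons size_wittS_seq ltnS le_ik IH.
Qed.

Lemma wittS_rec k :
  wittS p n k.+1 =
  mdivz (ghostX p n k.+1 + ghostY p n k.+1
         - \sum_(i < k.+1) (wittS p n i ^+ (p ^ (k.+1 - i))) *+ (p ^ i))
        (p ^ k.+1)%:Z.
Proof.
rewrite {1}/wittS /= nth_rcons size_wittS_seq ltnn eqxx.
congr (mdivz (_ - _) _); apply: eq_bigr => i _.
by rewrite nth_wittS_seq // -ltnS.
Qed.

Local Notation sigma := (zeval (fun i => 'X_i ^+ p : {mpoly int[n + n]})).

(** The terms with i <= k match exactly; the one remaining term, i = k+1, carries the factor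
    p^(k+1). *)
Let ghost_frobenius (h : 'I_n -> 'I_(n + n)) k :
  congr_mod (p ^ k.+1)
    (\sum_(i < n | (i <= k.+1)%N)
        (('X_(h i) : {mpoly int[n + n]}) ^+ (p ^ (k.+1 - i))) *+ (p ^ i))
    (sigma (\sum_(i < n | (i <= k)%N) ('X_(h i) ^+ (p ^ (k - i))) *+ (p ^ i))).
Proof.
rewrite rmorph_sum (bigID (fun i : 'I_n => (i <= k)%N)) /=.
rewrite -[X in congr_mod _ _ X]addr0; apply: congr_modD.
  rewrite (eq_bigl (fun i : 'I_n => (i <= k)%N)); last first.
    by move=> i; apply: andb_idl => /leqW.
  apply: congr_mod_sum => i le_ik; rewrite rmorphMn rmorphXn /= zevalX.
  by rewrite -exprM -expnS -subSn //; apply: congr_mod_refl.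
apply: (big_ind (congr_mod (p ^ k.+1) ^~ 0)) => [|z z' cz cz'|i].
- exact: congr_mod_refl.
- by rewrite -[0]addr0; apply: congr_modD.
rewrite -ltnNge => /andP[le_ik lt_ki].
have -> : (i : nat) = k.+1 by apply/eqP; rewrite eqn_leq le_ik.
by exists ('X_(h i) ^+ (p ^ (k.+1 - k.+1))); rewrite add0r.
Qed.

(* Dwork's argument: sigma lifts Frobenius, so sigma(w_k(S)) and
   w_(k+1)(S) - p^(k+1) S_(k+1) agree modulo p^(k+1). *)
Lemma ghost_wittS k :
  \sum_(i < k.+1) (wittS p n i ^+ (p ^ (k - i))) *+ (p ^ i)
  = ghostX p n k + ghostY p n k.
Proof.
elim: k => [|k IH].
  by rewrite big_ord_recr big_ord0 /= add0r subnn expn0 expr1 mulr1n.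
set W := \sum_(i < k.+1) (wittS p n i ^+ (p ^ (k.+1 - i))) *+ (p ^ i).
have [c Ec] : congr_mod (p ^ k.+1) (ghostX p n k.+1 + ghostY p n k.+1) W.
  apply: (@congr_mod_trans _ _ (sigma (ghostX p n k + ghostY p n k))).
    by rewrite rmorphD; apply: congr_modD; apply: ghost_frobenius.
  rewrite -IH rmorph_sum; apply: congr_mod_sum => i _.
  rewrite rmorphMn rmorphXn /=.
  have le_ik : (i <= k)%N by rewrite -ltnS.
  have -> : (p ^ k.+1 = p ^ i * p ^ (k - i).+1)%N by rewrite -expnD addnS subnKC.
 apply: congr_modMn; rewrite subSn // [wittS p n i ^+ _](_ : _ =
    (wittS p n i ^+ p) ^+ (p ^ (k - i))); last by rewrite expnS exprM.
  by apply: congr_mod_expX; apply: zeval_frobenius.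
rewrite big_ord_recr /= -/W wittS_rec -/W Ec addrAC subrr add0r.
by rewrite mdivzMn ?expn_gt0 ?p_gt0 // subnn expn0 expr1 addrC.
Qed.

End WittPolynomials.

(** * Witt vector addition over an arbitrary ring *)

Definition pair_vals (n : nat) (R : Type) (a b : witt R n) (j : 'I_(n + n)) : R :=
  match split j with inl i => a i | inr i => b i end.

Lemma pair_vals_lshift n (R : Type) (a b : witt R n) i :
  pair_vals a b (lshift n i) = a i.
Proof. by rewrite /pair_vals (unsplitK (inl i)). Qed.

Lemma pair_vals_rshift n (R : Type) (a b : witt R n) i :
  pair_vals a b (rshift n i) = b i.
Proof. by rewrite /pair_vals (unsplitK (inr i)). Qed.

(** The grading for which the k-th ghost polynomial, and hence S_k, is isobaric of weight p^k. *)
Definition witt_weight (p n : nat) (j : 'I_(n + n)) : nat :=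
  match split j with inl i | inr i => (p ^ i)%N end.

Definition mnm_witt_weight (p n : nat) (m : 'X_{1..n + n}) : nat :=
  (\sum_(j < n + n) m j * witt_weight p j)%N.

Lemma mnm_witt_weight0 p n : mnm_witt_weight p (0%MM : 'X_{1..n + n}) = 0%N.
Proof. by apply: big1 => j _; rewrite mnm0E mul0n. Qed.

Lemma mnm_witt_weightD p n :
  {morph @mnm_witt_weight p n : m1 m2 / (m1 + m2)%MM >-> (m1 + m2)%N}.
Proof.
by move=> m1 m2; rewrite -big_split; apply: eq_bigr => j _; rewrite mnmDE mulnDl.
Qed.

HB.instance Definition _ (p n : nat) :=
  isMeasure.Build (n + n)%N (@mnm_witt_weight p n)
    (@mnm_witt_weight0 p n) (@mnm_witt_weightD p n).

Lemma mnm_witt_weightU p n j : mnm_witt_weight p U_(j)%MM = @witt_weight p n j.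
Proof.
rewrite /mnm_witt_weight (bigD1 j) //= mnm1E eqxx mul1n big1 ?addn0 // => i ne_ij.
by rewrite mnm1E eq_sym (negbTE ne_ij).
Qed.

Section WittHomogeneity.
Variables (p n : nat).

Local Notation whomog d := (@ishomog1 (n + n) int d (@mnm_witt_weight p n)).

Let ghost_homog (h : 'I_n -> 'I_(n + n)) k :
  (forall i, witt_weight p (h i) = p ^ i)%N ->
  \sum_(i < n | (i <= k)%N) ('X_(h i) ^+ (p ^ (k - i))) *+ (p ^ i)
    \is whomog (p ^ k).
Proof.
move=> wh; apply: rpred_sum => i le_ik; apply: rpredMn.
have -> : (p ^ k = p ^ i * p ^ (k - i))%N by rewrite -expnD subnKC.
by apply: dhomogMn; rewrite dhomogX /= mnm_witt_weightU wh.
Qed.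

Let mdivz_homog q d k : q \is whomog k -> mdivz q d \is whomog k.
Proof.
move=> /dhomogP hq; rewrite /mdivz big_seq; apply: rpred_sum => m /hq hm.
by apply: dhomogZ; rewrite dhomogX hm.
Qed.

Lemma wittS_homog k : wittS p n k \is whomog (p ^ k).
Proof.
have gX i : ghostX p n i \is whomog (p ^ i).
  by apply: ghost_homog => j; rewrite /witt_weight (unsplitK (inl j)).
have gY i : ghostY p n i \is whomog (p ^ i).
  by apply: ghost_homog => j; rewrite /witt_weight (unsplitK (inr j)).
elim/ltn_ind: k => -[|k] IH; first exact: dhomogD.
rewrite wittS_rec; apply/mdivz_homog/rpredB; first exact: dhomogD.
apply: rpred_sum => i _; apply: rpredMn.
have -> : (p ^ k.+1 = p ^ i * p ^ (k.+1 - i))%N by rewrite -expnD subnKC // ltnW.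
by apply: dhomogMn; apply: IH.
Qed.

End WittHomogeneity.

Section WittSum.
Variables (p n : nat).
Hypothesis p_pr : prime p.

Let p_gt0 : (0 < p)%N := prime_gt0 p_pr.

Section AnyRing.
Variable R : comNzRingType.
Implicit Types a b c : witt R n.

(** Over a field this is convertible to [wadd], which lets the group laws proved here apply to the
    sums in [in_filF]. *)
Definition wsum a b : witt R n :=
  [ffun k : 'I_n => zeval (pair_vals a b) (wittS p n k)].

Definition ghost k a : R := \sum_(i < n | (i <= k)%N) (a i ^+ (p ^ (k - i))) *+ (p ^ i).

Definition wtrunc k a : witt R n := [ffun i : 'I_n => if (i < k)%N then a i else 0].

Lemma ghost_wsum k a b :
  (k < n)%N -> ghost k (wsum a b) = ghost k a + ghost k b.
Proof.
move=> lt_kn; have := congr1 (zeval (pair_vals a b)) (ghost_wittS n p_pr k).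
rewrite rmorph_sum rmorphD !rmorph_sum /= => E.
transitivity (\sum_(i < k.+1)
    zeval (pair_vals a b) (wittS p n i ^+ (p ^ (k - i)) *+ p ^ i)).
  rewrite (big_ord_widen n (fun i => zeval (pair_vals a b)
    (wittS p n i ^+ (p ^ (k - i)) *+ p ^ i))) //.
  by apply: eq_big => // i _; rewrite ffunE rmorphMn rmorphXn.
rewrite E; congr (_ + _); apply: eq_bigr => i _; rewrite rmorphMn rmorphXn /= zevalX.
  by rewrite pair_vals_lshift.
by rewrite pair_vals_rshift.
Qed.

Lemma ghostS (i : 'I_n) a : ghost i a = ghost i (wtrunc i a) + a i *+ (p ^ i).
Proof.
have E b : ghost i b = \sum_(j < n | (j < i)%N) (b j ^+ (p ^ (i - j))) *+ (p ^ j)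
    + b i *+ (p ^ i).
  rewrite /ghost (bigD1 i) //= subnn expr1 addrC; congr (_ + _).
  by apply: eq_bigl => j; rewrite ltn_neqAle andbC.
rewrite !E; congr (_ + _); rewrite ffunE ltnn mul0rn addr0.
by apply: eq_bigr => j lt_ji; rewrite ffunE lt_ji.
Qed.

(* A multiplicative filtration is enough to bound the isobaric polynomials S_k. *)
Lemma wsum_graded (P : nat -> R -> Prop) a b :
  (forall w, P w 0) -> (forall w x y, P w x -> P w y -> P w (x + y)) ->
  (forall w w' x y, P w x -> P w' y -> P (w + w')%N (x * y)) ->
  (forall z : int, P 0%N z%:~R) ->
  (forall i : 'I_n, P (p ^ i)%N (a i)) -> (forall i : 'I_n, P (p ^ i)%N (b i)) ->
  forall i : 'I_n, P (p ^ i)%N (wsum a b i).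
Proof.
move=> P0 PD PM PZ Pa Pb i; rewrite ffunE /zeval /mmap.
have Pv j : P (witt_weight p j) (pair_vals a b j).
  by rewrite /witt_weight /pair_vals; case: (split j).
have PX w x k : P w x -> P (k * w)%N (x ^+ k).
  move=> Pwx; elim: k => [|k IH]; first by rewrite mul0n expr0; apply: (PZ 1).
  by rewrite exprS mulSn; apply: PM.
rewrite big_seq; elim/big_ind: _ => [||m m_S]; [exact: P0 | exact: PD |].
rewrite -[(p ^ i)%N]add0n; apply: (PM) => //.
rewrite -(dhomog_mf (wittS_homog p n i) m_S) /= /mnm_witt_weight /mmap1.
apply: (big_ind2 (fun x w => P w x)) => [|x w y w' Px Py|j _].
- exact: (PZ 1).
- exact: PM.
- exact: PX.
Qed.

End AnyRing.

Section TorsionFree.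
Variable R : comNzRingType.
Hypothesis Rtf : forall x : R, x *+ p = 0 -> x = 0.
Implicit Types a b c : witt R n.

Let Rtfk k (x y : R) : x *+ (p ^ k) = y *+ (p ^ k) -> x = y.
Proof.
move/eqP; rewrite -subr_eq0 -mulrnBl => /eqP E.
apply/eqP; rewrite -subr_eq0; apply/eqP; elim: k E => [|k IH]; first by rewrite mulr1n.
by rewrite expnSr mulrnA => /Rtf/IH.
Qed.

Lemma ghost_inj a b : (forall k, (k < n)%N -> ghost k a = ghost k b) -> a = b.
Proof.
move=> gab; apply/ffunP => i; move: {2}(i : nat) (leqnn i) => m.
elim: m i => [|m IH] i le_im.
  have := gab i (ltn_ord i); rewrite (ghostS i a) (ghostS i b).
  have E c : wtrunc i c = [ffun=> 0].
    by apply/ffunP => j; rewrite !ffunE ltnNge (leq_trans le_im).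
  by rewrite !E => /addrI/Rtfk.
have := gab i (ltn_ord i); rewrite (ghostS i a) (ghostS i b).
have -> : wtrunc i a = wtrunc i b.
  apply/ffunP => j; rewrite !ffunE; case: ltnP => // lt_ji.
  by apply: IH; rewrite -ltnS (leq_trans lt_ji).
by move/addrI/Rtfk.
Qed.

Lemma wsumC_tf a b : wsum a b = wsum b a.
Proof. by apply: ghost_inj => k lt_kn; rewrite !ghost_wsum // addrC. Qed.

Lemma wsumA_tf a b c : wsum a (wsum b c) = wsum (wsum a b) c.
Proof. by apply: ghost_inj => k lt_kn; rewrite !ghost_wsum // addrA. Qed.

Lemma wsum0_tf a : wsum a [ffun=> 0] = a.
Proof.
apply: ghost_inj => k lt_kn; rewrite ghost_wsum // [X in _ + X]big1 ?addr0 // => i _.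
by rewrite ffunE expr0n eqn0Ngt expn_gt0 p_gt0 mul0rn.
Qed.

(** The carry into component i depends on lower components only: by induction the sum and the sum of
    the truncations agree below i, so their i-th ghost equations differ only in p^i times component
    i. *)
Lemma wsumE_tf a b (i : 'I_n) :
  wsum a b i = a i + b i + wsum (wtrunc i a) (wtrunc i b) i.
Proof.
elim/ltn_ind: {i}(i : nat) {-2}i (erefl (i : nat)) a b => k IH i Ei a b.
have := ghost_wsum a b (ltn_ord i).
have := ghost_wsum (wtrunc i a) (wtrunc i b) (ltn_ord i).
rewrite (ghostS i (wsum _ _)) (ghostS i (wsum a b)) (ghostS i a) (ghostS i b).
have -> : wtrunc i (wsum (wtrunc i a) (wtrunc i b)) = wtrunc i (wsum a b).
  apply/ffunP => j; rewrite ![wtrunc _ _ _]ffunE; case: ltnP => // lt_ji.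
  have lt_jk : (j < k)%N by rewrite -Ei.
  rewrite (IH _ lt_jk j erefl (wtrunc i a)) (IH _ lt_jk j erefl a b).
  rewrite ![wtrunc i _ j]ffunE lt_ji.
  have E c : wtrunc j (wtrunc i c) = wtrunc j c.
    apply/ffunP => l; rewrite !ffunE; case: ltnP => // lt_lj.
    by rewrite (ltn_trans lt_lj).
  by rewrite !E.
rewrite addrACA => <-; rewrite -addrA => /addrI.
by rewrite -!mulrnDl => /Rtfk->; rewrite addrC.
Qed.

End TorsionFree.
End WittSum.

Section WittGroup.
Variables (p n : nat).
Hypothesis p_pr : prime p.

Local Notation wsum := (@wsum p n _).

Lemma rmorph_wsum (R S : comNzRingType) (f : {rmorphism R -> S}) (a b : witt R n) :
  [ffun i => f (wsum a b i)] = wsum [ffun i => f (a i)] [ffun i => f (b i)].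
Proof.
apply/ffunP => i; rewrite !ffunE rmorph_zeval; apply: eq_zeval => j /=.
by rewrite /pair_vals; case: (split j) => k; rewrite ffunE.
Qed.

Lemma mpolyint_torsion_free N (x : {mpoly int[N]}) : x *+ p = 0 -> x = 0.
Proof.
move=> xp0; apply/mpolyP => m; apply/eqP.
have /eqP : (x *+ p)@_m = 0 by rewrite xp0 mcoeff0.
by rewrite mcoeffMn mulrn_eq0 mcoeff0 eqn0Ngt prime_gt0.
Qed.

(** Reduction to the universal case. In characteristic p ghost components do not determine a vector,
    but any three vectors are images of vectors of variables over the torsion-free ring of integer
    polynomials. *)
Lemma witt_generic (R : comNzRingType) (a b c : witt R n) :
  exists (f : {rmorphism {mpoly int[n + (n + n)]} -> R})
         (A B C : witt {mpoly int[n + (n + n)]} n),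
  [/\ a = [ffun i => f (A i)], b = [ffun i => f (B i)] & c = [ffun i => f (C i)]].
Proof.
pose h (j : 'I_(n + (n + n))) :=
  match split j with inl i => a i | inr j => pair_vals b c j end.
exists (zeval h : {rmorphism _ -> _}), [ffun i => 'X_(lshift _ i)],
  [ffun i => 'X_(rshift _ (lshift _ i))], [ffun i => 'X_(rshift _ (rshift _ i))].
split; apply/ffunP => i; rewrite !ffunE /= zevalX /h.
- by rewrite (unsplitK (inl i)).
- by rewrite (unsplitK (inr _)) pair_vals_lshift.
- by rewrite (unsplitK (inr _)) pair_vals_rshift.
Qed.

Section Laws.
Variable R : comNzRingType.
Implicit Types a b c : witt R n.

Lemma wsumC : commutative (wsum : witt R n -> _).
Proof.
move=> a b; have [f [A [B [_ [-> -> _]]]]] := witt_generic a b a.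
by rewrite -!rmorph_wsum wsumC_tf //; apply: mpolyint_torsion_free.
Qed.

Lemma wsumA : associative (wsum : witt R n -> _).
Proof.
move=> a b c; have [f [A [B [C [-> -> ->]]]]] := witt_generic a b c.
by rewrite -!rmorph_wsum wsumA_tf //; apply: mpolyint_torsion_free.
Qed.

Lemma wsum0 a : wsum a [ffun=> 0] = a.
Proof.
have [f [A [_ [_ [-> _ _]]]]] := witt_generic a a a.
have -> : [ffun=> 0] = [ffun i : 'I_n => f (([ffun=> 0] : witt _ n) i)].
  by apply/ffunP => i; rewrite !ffunE rmorph0.
by rewrite -rmorph_wsum wsum0_tf //; apply: mpolyint_torsion_free.
Qed.

Lemma wsumE a b (i : 'I_n) :
  wsum a b i = a i + b i + wsum (wtrunc i a) (wtrunc i b) i.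
Proof.
have [f [A [B [_ [-> -> _]]]]] := witt_generic a b a.
have tE (C : witt _ n) : wtrunc i [ffun j => f (C j)] = [ffun j => f (wtrunc i C j)].
  by apply/ffunP => j; rewrite !ffunE; case: ifP; rewrite ?rmorph0.
rewrite (tE A) (tE B).
rewrite -(rmorph_wsum f A B) -(rmorph_wsum f (wtrunc i A)).
rewrite [LHS]ffunE.
rewrite [X in f X](wsumE_tf p_pr (@mpolyint_torsion_free _) A B i).
by rewrite !rmorphD; congr (_ + _ + _); rewrite [RHS]ffunE.
Qed.

(** By [wsumE] the system is triangular in the components of b. This yields opposites without a
    closed formula, which would depend on the parity of p. *)
Lemma wsum_solve a c : exists b, wsum a b = c.
Proof.
suff H k : exists b, forall i : 'I_n, (i < k)%N -> wsum a b i = c i.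
  by have [b Eb] := H n; exists b; apply/ffunP => i; rewrite Eb.
elim: k => [|k [b Eb]]; first by exists a.
pose d (i : 'I_n) := c i - a i - wsum (wtrunc i a) (wtrunc i b) i.
exists [ffun i : 'I_n => if (i < k)%N then b i else d i] => i.
have bE j : (j <= k)%N ->
    wtrunc j [ffun i : 'I_n => if (i < k)%N then b i else d i] = wtrunc j b.
  move=> le_jk; apply/ffunP => l; rewrite !ffunE; case: ltnP => // lt_lj.
  by rewrite (leq_trans lt_lj).
rewrite ltnS leq_eqVlt => /orP[/eqP Ei|lt_ik].
  by rewrite wsumE bE ?Ei // ffunE Ei ltnn /d Ei [_ + (_ - _)]addrA subrK addrC subrK.
by rewrite wsumE bE 1?ltnW // ffunE lt_ik -wsumE Eb.
Qed.

End Laws.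
End WittGroup.

(* An alias is needed because [witt R n] already carries the pointwise addition of
   finite functions. *)
Definition wittg (p : nat) (p_pr : prime p) (n : nat) (R : comNzRingType) : Type :=
  witt R n.

Section WittZmodule.
Variables (p : nat) (p_pr : prime p) (n : nat) (R : comNzRingType).

HB.instance Definition _ := Choice.on (wittg p_pr n R).

Let wsum_solve_eq (a : wittg p_pr n R) :
  exists b : wittg p_pr n R, wsum p a b == [ffun=> 0].
Proof. by have [b Eb] := wsum_solve p_pr a [ffun=> 0]; exists b; apply/eqP. Qed.

Definition wopp (a : wittg p_pr n R) : wittg p_pr n R := xchoose (wsum_solve_eq a).

Let wsum0l : left_id [ffun=> 0] (@wsum p n R).
Proof. by move=> a; rewrite wsumC // wsum0. Qed.

Let wsumNl : left_inverse ([ffun=> 0] : wittg p_pr n R) wopp (@wsum p n R).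
Proof. by move=> a; rewrite wsumC //; apply/eqP/(xchooseP (wsum_solve_eq a)). Qed.

HB.instance Definition _ := GRing.isZmodule.Build (wittg p_pr n R)
  (@wsumA p n p_pr R) (@wsumC p n p_pr R) wsum0l wsumNl.

End WittZmodule.

(** * Valuations and the Brylinski-Kato filtration *)

(** The factor D puts all components on one scale: with D = p^(n-1), the condition p^(n-1-i) v(a_i)
    >= -m becomes D v(a_i) >= -m p^i, proportional to the weight p^i of the i-th variables. *)
Definition valbnd (L : fieldType) (D : nat) (v : L -> int) (c : int) (x : L) : bool :=
  (x == 0) || (c <= D%:Z * v x).

Section Valuation.
Variables (L : fieldType) (v : L -> int).
Hypothesis v_val : is_dvaluation v.

Lemma dvalM x y : x != 0 -> y != 0 -> v (x * y) = v x + v y.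
Proof. by case: v_val => vM _ _; apply: vM. Qed.

Lemma dvalD x y : x != 0 -> y != 0 -> x + y != 0 -> Num.min (v x) (v y) <= v (x + y).
Proof. by case: v_val => _ vD _; apply: vD. Qed.

Lemma dval1 : v 1 = 0.
Proof.
have := dvalM (oner_neq0 L) (oner_neq0 L); rewrite mulr1 => /eqP.
by rewrite -subr_eq0 opprD addrA subrr add0r oppr_eq0 => /eqP.
Qed.

Lemma dvalN x : v (- x) = v x.
Proof.
have [->|x0] := eqVneq x 0; first by rewrite oppr0.
have N1 : (-1 : L) != 0 by rewrite oppr_eq0 oner_eq0.
suff vN1 : v (-1) = 0 by rewrite -mulN1r dvalM // vN1 add0r.
have /eqP := dvalM N1 N1; rewrite mulrNN mulr1 dval1 eq_sym.
by rewrite -mulr2n mulrn_eq0 /= => /eqP.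
Qed.

Lemma dvalX x k : x != 0 -> v (x ^+ k) = v x *+ k.
Proof.
move=> x0; elim: k => [|k IH]; first by rewrite dval1.
by rewrite exprS dvalM ?expf_neq0 // IH mulrS.
Qed.

Lemma dvalV x : x != 0 -> v x^-1 = - v x.
Proof.
move=> x0; apply/eqP; rewrite -addr_eq0 -dvalM ?invr_neq0 //.
by rewrite mulVf // dval1.
Qed.

Lemma valbnd0 D c : valbnd D v c 0.
Proof. by rewrite /valbnd eqxx. Qed.

Lemma valbndD D c x y : valbnd D v c x -> valbnd D v c y -> valbnd D v c (x + y).
Proof.
rewrite /valbnd; have [->|x0] := eqVneq x 0; first by rewrite add0r.
have [->|y0] := eqVneq y 0; first by rewrite addr0 (negbTE x0).
have [//|xy0] := eqVneq (x + y) 0; move=> /= cx cy.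
have := dvalD x0 y0 xy0; rewrite minEle; case: ifP => _ le_v.
  by apply: le_trans cx _; apply: ler_wpM2l.
by apply: le_trans cy _; apply: ler_wpM2l.
Qed.

Lemma valbndN D c x : valbnd D v c (- x) = valbnd D v c x.
Proof. by rewrite /valbnd oppr_eq0 dvalN. Qed.

Lemma valbndB D c x y : valbnd D v c x -> valbnd D v c y -> valbnd D v c (x - y).
Proof. by move=> cx cy; apply: valbndD; rewrite ?valbndN. Qed.

Lemma valbndM D c c' x y :
  valbnd D v c x -> valbnd D v c' y -> valbnd D v (c + c') (x * y).
Proof.
rewrite /valbnd mulf_eq0; have [//|x0] := eqVneq x 0.
by have [//|y0] /= := eqVneq y 0; rewrite dvalM // mulrDr; apply: lerD.
Qed.

Lemma valbnd_int D (z : int) : valbnd D v 0 z%:~R.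
Proof.
have Hn (k : nat) : valbnd D v 0 k%:R.
  elim: k => [|k IH]; first exact: valbnd0.
  rewrite -addn1 natrD; apply: valbndD => //.
  by rewrite /valbnd dval1 mulr0 lexx orbT.
by case: z => k; rewrite ?NegzE ?mulrNz ?valbndN; apply: Hn.
Qed.

Lemma valbndW D c c' x : c' <= c -> valbnd D v c x -> valbnd D v c' x.
Proof.
by rewrite /valbnd => le_c /predU1P[->|/(le_trans le_c)->]; rewrite ?eqxx ?orbT.
Qed.

End Valuation.

Section WittValuation.
Variables (p n : nat) (L : fieldType) (v : L -> int).
Hypothesis (p_pr : prime p) (v_val : is_dvaluation v).
Variables (D m : nat).
Implicit Types a b : witt L n.

Let wbnd (w : nat) (x : L) := valbnd D v (- (m * w)%:Z) x.
Let wbndS (w : nat) (x : L) := valbnd D v (- (m * w)%:Z + 1) x.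

Lemma wsum_bnd a b :
  (forall i : 'I_n, wbnd (p ^ i) (a i)) -> (forall i : 'I_n, wbnd (p ^ i) (b i)) ->
  forall i : 'I_n, wbnd (p ^ i) (wsum p a b i).
Proof.
move=> Ba Bb; apply: (wsum_graded (P := wbnd)) => // [w|w x y|w w' x y|z].
- exact: valbnd0.
- exact: valbndD.
- by move=> Bx By; rewrite /wbnd mulnDr PoszD opprD; apply: valbndM.
- by rewrite /wbnd muln0; apply: valbnd_int.
Qed.

Lemma wsum_trunc_bnd a b (i : 'I_n) :
  (forall j : 'I_n, (j < i)%N -> wbnd (p ^ j) (a j)) ->
  (forall j : 'I_n, (j < i)%N -> wbnd (p ^ j) (b j)) ->
  wbnd (p ^ i) (wsum p (wtrunc i a) (wtrunc i b) i).
Proof.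
by move=> Ba Bb; apply: wsum_bnd => j; rewrite ffunE; case: ifP => [|_];
  by [apply: Ba | apply: Bb | move=> _; apply: valbnd0 | apply: valbnd0].
Qed.

(* Both evaluations run simultaneously in the product ring [L * L]. *)
Lemma wsum_trunc_bndS a b (i : 'I_n) :
  (forall j : 'I_n, (j < i)%N -> wbnd (p ^ j) (a j)) ->
  (forall j : 'I_n, (j < i)%N -> wbndS (p ^ j) (b j)) ->
  wbndS (p ^ i) (wsum p (wtrunc i a) (wtrunc i b) i).
Proof.
move=> Ba Bb.
(* The first coordinate computes the sum of the truncations of a and b, the second that of the
   truncation of a and 0, whose component i vanishes. The gain of 1 on the difference is thus the
   claim. *)
pose P w (z : L * L) := [/\ wbnd w z.1, wbnd w z.2 & wbndS w (z.1 - z.2)].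
have PL w x : wbndS w x -> wbnd w x by apply: valbndW; rewrite lerDl.
pose a2 : witt (L * L)%type n := [ffun j => (wtrunc i a j, wtrunc i a j)].
pose b2 : witt (L * L)%type n := [ffun j => (wtrunc i b j, 0)].
have [] : P (p ^ i)%N (wsum p a2 b2 i).
  apply: (wsum_graded (P := P)) => [w|w x y|w w' x y|z|j|j].
  - by split=> /=; rewrite ?subrr; apply: valbnd0.
  - move=> [? ? ?] [? ? ?]; split; [exact: valbndD|exact: valbndD|].
    by rewrite opprD addrACA; apply: valbndD.
  - move=> [Bx1 Bx2 Bx] [By1 By2 By]; split.
    + by rewrite /wbnd mulnDr PoszD opprD; apply: valbndM.
    + by rewrite /wbnd mulnDr PoszD opprD; apply: valbndM.
    have -> : (x * y).1 - (x * y).2 = (x.1 - x.2) * y.1 + x.2 * (y.1 - y.2).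
      by rewrite mulrBl mulrBr addrA subrK.
    rewrite /wbndS mulnDr PoszD opprD; apply: valbndD => //.
      by rewrite addrAC; apply: valbndM.
    by rewrite -addrA; apply: valbndM.
  - have -> : (z%:~R : L * L) = (z%:~R, z%:~R).
      rewrite [LHS]surjective_pairing; congr (_, _).
        exact: (rmorph_int (fst : {rmorphism L * L -> L})).
      exact: (rmorph_int (snd : {rmorphism L * L -> L})).
    split=> /=; rewrite ?subrr; try exact: valbnd0; rewrite /wbnd muln0;
      exact: valbnd_int.
  - rewrite !ffunE; case: ifP => [/Ba Baj|_]; split=> //=; rewrite ?subrr;
      exact: valbnd0.
  - rewrite !ffunE; case: ifP => [/Bb Bbj|_]; split=> /=; rewrite ?subr0 //;
      by [apply: PL | apply: valbnd0].
have -> : (wsum p a2 b2 i).1 = wsum p (wtrunc i a) (wtrunc i b) i.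
  have := rmorph_wsum p (fst : {rmorphism L * L -> L}) a2 b2.
  move/(congr1 (fun c : witt L n => c i)); rewrite ffunE => ->.
  by congr (wsum p _ _ i); apply/ffunP => j; rewrite !ffunE.
have -> : (wsum p a2 b2 i).2 = 0.
  have := rmorph_wsum p (snd : {rmorphism L * L -> L}) a2 b2.
  move/(congr1 (fun c : witt L n => c i)); rewrite ffunE => ->.
  rewrite (_ : [ffun j => _] = wtrunc i a); last by apply/ffunP => j; rewrite !ffunE.
  rewrite (_ : [ffun j => _] = [ffun=> 0]); last by apply/ffunP => j; rewrite !ffunE.
  by rewrite wsum0 // ffunE ltnn.
by rewrite subr0.
Qed.

End WittValuation.

Section Filtration.
Variables (p n : nat) (L : fieldType) (v : L -> int).
Hypothesis (p_pr : prime p) (charL : p \in [pchar L]) (v_val : is_dvaluation v).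
Local Notation W := (wittg p_pr n L).
Implicit Types a b : W.

Let p_gt0 : (0 < p)%N := prime_gt0 p_pr.

Lemma wfrobD a b : wfrob p (a + b : W) = (wfrob p a : W) + wfrob p b.
Proof.
have := rmorph_wsum p (pFrobenius_aut charL) a b.
have E c : [ffun i => pFrobenius_aut charL ((c : witt L n) i)] = wfrob p c.
  by apply/ffunP => i; rewrite !ffunE pFrobenius_autE.
by rewrite !E.
Qed.

Lemma wfrob0 : wfrob p (0 : W) = 0 :> W.
Proof. by apply: (@addrI _ (wfrob p (0 : W) : W)); rewrite -wfrobD !addr0. Qed.

Lemma wfrobN a : wfrob p (- a : W) = - (wfrob p a : W).
Proof.
by apply: (@addrI _ (wfrob p a : W)); rewrite -wfrobD !subrr wfrob0.
Qed.

Lemma expn_split (i : 'I_n) : (p ^ n.-1 = p ^ (n.-1 - i) * p ^ i)%N.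
Proof. by rewrite -expnD subnK // -ltnS (ltn_predK (ltn_ord i)). Qed.

Lemma valbnd_scale (i : 'I_n) (c : int) (x : L) :
  valbnd (p ^ n.-1) v (c * (p ^ i)%:Z) x = valbnd (p ^ (n.-1 - i)) v c x.
Proof.
rewrite /valbnd (expn_split i) PoszM mulrAC ler_pM2r //.
by rewrite ltz_nat expn_gt0 p_gt0.
Qed.

Lemma in_filP m a : in_fil p v m a <->
  forall i : 'I_n, valbnd (p ^ n.-1) v (- (m * p ^ i)%:Z) ((a : witt L n) i).
Proof.
by split=> fa i; have := fa i; rewrite PoszM -mulNr valbnd_scale.
Qed.

(** The +1 expresses a strict inequality. Cancelling p^i leaves p^(n-1-i) v(a_i) > -m between
    integers, that is >= -(m-1). *)
Lemma in_fil_pred m a : (0 < m)%N ->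
  (forall i : 'I_n, valbnd (p ^ n.-1) v (- (m * p ^ i)%:Z + 1) ((a : witt L n) i)) ->
  in_fil p v m.-1 a.
Proof.
move=> m_gt0 fa i; have := fa i; rewrite /valbnd; case: eqP => //= _.
rewrite lezD1 (expn_split i) !PoszM mulrAC -mulNr ltr_pM2r ?ltz_nat ?expn_gt0 ?p_gt0 //.
by rewrite -lezD1; case: m m_gt0 {fa} => //= m _; rewrite intS opprD addrAC addNr add0r.
Qed.

Lemma in_filW m m' a : (m <= m')%N -> in_fil p v m a -> in_fil p v m' a.
Proof.
move=> le_m fa i; have /orP[->//|le_v] := fa i; apply/orP; right.
by apply: le_trans le_v; rewrite lerN2 lez_nat.
Qed.

Lemma in_fil0 m : in_fil p v m (0 : W).
Proof. by move=> i; rewrite ffunE eqxx. Qed.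

Lemma in_filD m a b : in_fil p v m a -> in_fil p v m b -> in_fil p v m (a + b : W).
Proof. by move=> /in_filP fa /in_filP fb; apply/in_filP; apply: wsum_bnd. Qed.

Lemma waddE a b (i : 'I_n) :
  ((a + b : W) : witt L n) i =
  (a : witt L n) i + (b : witt L n) i + wsum p (wtrunc i a) (wtrunc i b) i.
Proof. exact: wsumE. Qed.

(** Component i of a + (-a) = 0 expresses the i-th component of -a by that of a and a carry from
    lower components, bounded by induction. *)
Lemma in_filN m a : in_fil p v m a -> in_fil p v m (- a : W).
Proof.
move=> /in_filP fa; apply/in_filP => i; set b : W := - a.
elim/ltn_ind: {i}(i : nat) {-2}i (erefl (i : nat)) => k IH i Ei.
have := waddE a b i; rewrite subrr ffunE => /esym/eqP.
rewrite addrAC addrC addr_eq0 => /eqP->; rewrite valbndN //; apply: valbndD => //.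
by apply: wsum_trunc_bnd => // j; rewrite Ei => lt_j; apply: IH lt_j _ _.
Qed.

Lemma in_fil_frob m a : in_fil p v m (wfrob p a) -> in_fil p v m a.
Proof.
move=> fFa i; have := fFa i; rewrite ffunE expf_eq0 p_gt0 /=.
have [//|ai0] /= := eqVneq ((a : witt L n) i) 0; rewrite dvalX // => le_v.
have [v0|v0] := leP 0 (v (a i)).
  by apply: le_trans (_ : 0 <= _); rewrite ?oppr_le0 // mulr_ge0.
apply: le_trans le_v _; apply: ler_wpM2l => //.
by rewrite -mulr_natr natz; apply: ler_neMr; [apply: ltW | apply: p_gt0].
Qed.

Lemma in_fil_exists a : exists m, in_fil p v m a.
Proof.
exists (\sum_(i < n) absz ((p ^ (n.-1 - i))%:Z * v ((a : witt L n) i))%R)%N => i.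
apply/orP; right; rewrite lerNl; apply: le_trans (ler_norm _) _.
by rewrite normrN -abszE lez_nat (bigD1 i) //= leq_addr.
Qed.

(** Horner form x_0 + F(x_1 + F(x_2 + ...)) of the sum of the F^j(x_j), suited to induction from the
    first summand. *)
Fixpoint in_filF_upto (m J : nat) (a : W) : Prop :=
  match J with
  | 0 => a = 0
  | J'.+1 => exists x b : W,
      [/\ in_fil p v m x, in_filF_upto m J' b & a = x + wfrob p b]
  end.

Lemma in_filFE m a : in_filF p v m a <-> exists J, in_filF_upto m J a.
Proof.
have foldF s (x : nat -> witt L n) :
    foldr (@wadd L p n) (wzero L n) [seq iter j.+1 (@wfrob L p n) (x j) | j <- s]
    = wfrob p (foldr (@wadd L p n) (wzero L n)
                 [seq iter j (@wfrob L p n) (x j) | j <- s]).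
  elim: s => [|j s IH] /=; first exact/esym/wfrob0.
  by rewrite IH; apply/esym/wfrobD.
have shift J (x : nat -> witt L n) :
    foldr (@wadd L p n) (wzero L n) [seq iter j (@wfrob L p n) (x j) | j <- iota 0 J.+1]
    = (x 0%N : W) + wfrob p (foldr (@wadd L p n) (wzero L n)
         [seq iter j (@wfrob L p n) (x j.+1) | j <- iota 0 J]).
  rewrite /= (_ : iota 1 J = map S (iota 0 J)); last first.
    by rewrite -[1%N]addn0 iotaDl.
  by rewrite -map_comp; apply: (congr1 (fun z : W => (x 0%N : W) + z)); apply: foldF.
split=> -[J]; elim: J a => [|J IH] a.
- by case=> x [_ ->]; exists 0%N.
- case=> x [fx Ea]; pose b := foldr (@wadd L p n) (wzero L n)
         [seq iter j (@wfrob L p n) (x j.+1) | j <- iota 0 J].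
  have [|J' fb] := IH b; first by exists (fun j => x j.+1); split.
  exists J'.+1, (x 0%N), b.
  by split; [exact: fx | exact: fb | exact: etrans Ea (shift J x)].
- by move=> ->; exists 0%N, (fun=> 0); split=> // j; apply: in_fil0.
case=> x [b [fx fb ->]]; have [J' [y [fy Eb]]] := IH b fb.
exists J'.+1, (fun j => if j is j'.+1 then y j' else x); split; first by case.
by rewrite shift /= -Eb.
Qed.

Lemma in_filF0 m : in_filF p v m (0 : W).
Proof. by apply/in_filFE; exists 0%N. Qed.

Lemma in_filF_cons m a b :
  in_fil p v m a -> in_filF p v m b -> in_filF p v m (a + wfrob p b : W).
Proof.
move=> fa /in_filFE[J fb]; apply/in_filFE; exists J.+1, a, b; split=> //.
Qed.

Lemma in_filF_inv m a : in_filF p v m a ->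
  exists x b : W, [/\ in_fil p v m x, in_filF p v m b & a = x + wfrob p b].
Proof.
case/in_filFE=> -[|J].
  by move=> ->; exists 0, 0; split;
    [apply: in_fil0 | apply: in_filF0 | rewrite wfrob0 addr0].
by case=> x [b [fx fb ->]]; exists x, b; split=> //; apply/in_filFE; exists J.
Qed.

Lemma in_filF_ind m (P : W -> Prop) :
  P 0 ->
  (forall x b : W, in_fil p v m x -> in_filF p v m b -> P b -> P (x + wfrob p b)) ->
  forall a, in_filF p v m a -> P a.
Proof.
move=> P0 PS a /in_filFE[J]; elim: J a => [|J IH] a; first by move=> ->.
case=> x [b [fx fb ->]]; apply: PS (IH _ fb) => //.
by apply/in_filFE; exists J.
Qed.

Lemma in_fil_filF m a : in_fil p v m a -> in_filF p v m a.
Proof.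
by move=> fa; rewrite -[a]addr0 -wfrob0; apply: in_filF_cons (in_filF0 m).
Qed.

Lemma in_filFW m m' a : (m <= m')%N -> in_filF p v m a -> in_filF p v m' a.
Proof.
move=> le_m; move: a; apply: in_filF_ind => [|x b fx _ fb]; first exact: in_filF0.
exact: in_filF_cons (in_filW le_m fx) fb.
Qed.

Lemma in_filFN m a : in_filF p v m a -> in_filF p v m (- a : W).
Proof.
move: a; apply: in_filF_ind => [|x b fx _ fb]; first by rewrite oppr0; apply: in_filF0.
by rewrite opprD -wfrobN; apply: in_filF_cons fb; apply: in_filN.
Qed.

Lemma in_filFD m a b : in_filF p v m a -> in_filF p v m b -> in_filF p v m (a + b : W).
Proof.
move=> fa; move: a fa b; apply: in_filF_ind => [|x a fx _ IH] b.
  by rewrite add0r.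
case/in_filF_inv=> y [c [fy fc ->]]; rewrite addrACA -wfrobD.
by apply: in_filF_cons; [apply: in_filD | apply: IH].
Qed.

(** If F(a) = x + F(b), then x = F(a - b) lies in fil_m, and so does a - b, since taking p-th roots
    can only weaken a pole. *)
Lemma in_filF_frob m a : in_filF p v m (wfrob p a) -> in_filF p v m a.
Proof.
case/in_filF_inv=> x [b [fx fb Ea]].
have Ex : x = wfrob p (a - b : W) by rewrite wfrobD wfrobN Ea addrK.
rewrite -[a](subrK b); apply: in_filFD fb; apply: in_fil_filF.
by apply: in_fil_frob; rewrite -Ex.
Qed.

Lemma decPP (P : Prop) : reflect P (Defs.decP P).
Proof.
by rewrite /Defs.decP; case: ClassicalEpsilon.excluded_middle_informative; constructor.
Qed.

Lemma swanP a : in_filF p v (swan p v a) a /\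
  forall m, in_filF p v m a -> (swan p v a <= m)%N.
Proof.
rewrite /swan; case: ClassicalEpsilon.excluded_middle_informative => [H|[]].
  case: ex_minnP => m /decPP fm min_m; split=> // k fk.
  by apply: min_m; apply/decPP.
by have [m fm] := in_fil_exists a; exists m; apply/decPP/in_fil_filF.
Qed.

End Filtration.

(** * Behaviour of the filtration under extension of the field *)

Section BaseChange.
Variables (p n : nat) (K K' : fieldType) (iota : {rmorphism K -> K'}).
Variables (v : K -> int) (v' : K' -> int) (e : nat).
Hypothesis (p_pr : prime p) (charK : p \in [pchar K]).
Hypothesis v'E : forall x : K, x != 0 -> v' (iota x) = e%:Z * v x.
Local Notation W := (wittg p_pr n K).
Local Notation W' := (wittg p_pr n K').

Lemma wmapD (a b : W) :
  wmap iota (a + b : W) = (wmap iota a : W') + wmap iota b.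
Proof. exact: (rmorph_wsum p iota a b). Qed.

Lemma wmap_frob (a : witt K n) : wmap iota (wfrob p a) = wfrob p (wmap iota a).
Proof. by apply/ffunP => i; rewrite !ffunE rmorphXn. Qed.

Lemma valbnd_map D c x : valbnd D v c x -> valbnd D v' (e%:Z * c) (iota x).
Proof.
rewrite /valbnd fmorph_eq0; have [//|x0] /= := eqVneq x 0.
by move=> le_v; rewrite v'E // mulrCA; apply: ler_wpM2l.
Qed.

Lemma in_fil_map m (a : W) : in_fil p v m a -> in_fil p v' (e * m) (wmap iota a).
Proof.
move=> fa i; have := valbnd_map (fa i : valbnd _ _ _ _).
by rewrite ffunE PoszM -mulrN.
Qed.

Lemma in_filF_map m (a : W) : in_filF p v m a -> in_filF p v' (e * m) (wmap iota a).
Proof.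
have charK' : p \in [pchar K'] by rewrite (rmorph_pchar iota).
apply: (in_filF_ind charK (P := fun a => in_filF p v' (e * m) (wmap iota a))).
  rewrite (_ : wmap iota _ = 0 :> W'); first exact: (in_filF0 _ _ p_pr charK').
  by apply/ffunP => i; rewrite !ffunE rmorph0.
move=> x b fx _ fb; rewrite wmapD wmap_frob.
exact: (in_filF_cons (p_pr := p_pr) charK' (in_fil_map fx) fb).
Qed.

End BaseChange.

(** * A component far from p-th powers that bounds the conductor over extensions *)

Section Witness.
Variables (p n : nat) (K : fieldType) (v : K -> int).
Hypothesis (p_pr : prime p) (charK : p \in [pchar K]) (v_val : is_dvaluation v).
Local Notation W := (wittg p_pr n K).
Local Notation D := (p ^ n.-1)%N.

Let p_gt0 : (0 < p)%N := prime_gt0 p_pr.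

(** The vector g collects the approximate p-th roots below k and is 0 from k on, so component k of z
    = x - F(g) differs from that of x by a carry only. Each carry involves some lower component of
    z, where 1 has been gained, and so gains 1 as well. *)
Lemma frobenius_split m k (x : W) : in_fil p v m x ->
  (forall i : 'I_n, (i < k)%N -> exists g : K,
     valbnd D v (- (m * p ^ i)%:Z + 1) ((x : witt K n) i - g ^+ p)) ->
  exists g z : W,
  [/\ x = (wfrob p g : W) + z,
      forall i : 'I_n, (i < k)%N ->
        valbnd D v (- (m * p ^ i)%:Z) ((g : witt K n) i ^+ p),
      forall i : 'I_n, (i < k)%N ->
        valbnd D v (- (m * p ^ i)%:Z + 1) ((z : witt K n) i)
    & forall i : 'I_n, i = k :> nat ->
        valbnd D v (- (m * p ^ i)%:Z + 1) ((z : witt K n) i - (x : witt K n) i)].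
Proof.
move=> /in_filP fx good.
have /fin_all_exists[g0 g0P] : forall i : 'I_n, exists y : K,
    if (i < k)%N then valbnd D v (- (m * p ^ i)%:Z + 1) ((x : witt K n) i - y ^+ p)
    else y == 0.
  by move=> i; case: ltnP => [/good//|_]; exists 0.
pose g : W := [ffun i => g0 i]; pose z : W := x - (wfrob p g : W).
have Ex : x = (wfrob p g : W) + z by rewrite /z addrC subrK.
have gbnd (i : 'I_n) : (i < k)%N ->
    valbnd D v (- (m * p ^ i)%:Z) ((g : witt K n) i ^+ p).
  move=> lt_ik; have := g0P i; rewrite lt_ik => gi; rewrite ffunE.
  have -> : g0 i ^+ p = (x : witt K n) i - ((x : witt K n) i - g0 i ^+ p).
    by rewrite opprB addrC subrK.
  by apply: valbndB => //; apply: valbndW gi; rewrite lerDl.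
have zE (i : 'I_n) : (z : witt K n) i = (x : witt K n) i - (wfrob p g : witt K n) i
    - wsum p (wtrunc i (wfrob p g)) (wtrunc i z) i.
  have := waddE (wfrob p g : W) z i; rewrite -Ex => ->.
  by rewrite [RHS]addrAC addrK addrAC subrr add0r.
have cross (i : 'I_n) : (i <= k)%N -> (forall j : 'I_n, (j < i)%N ->
      valbnd D v (- (m * p ^ j)%:Z + 1) ((z : witt K n) j)) ->
    valbnd D v (- (m * p ^ i)%:Z + 1)
      (wsum p (wtrunc i (wfrob p g)) (wtrunc i z) i).
  move=> le_ik zj; apply: wsum_trunc_bndS => // j lt_ji; rewrite ffunE.
  by apply: gbnd; apply: leq_trans le_ik.
have zbnd (i : 'I_n) : (i < k)%N ->
    valbnd D v (- (m * p ^ i)%:Z + 1) ((z : witt K n) i).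
  elim/ltn_ind: {i}(i : nat) {-2}i (erefl (i : nat)) => l IH i Ei lt_ik.
  rewrite zE; apply: valbndB => //.
    by have := g0P i; rewrite lt_ik !ffunE.
  apply: cross (ltnW lt_ik) _ => j lt_ji; apply: (IH j) => //; rewrite -?Ei //.
  exact: ltn_trans lt_ji lt_ik.
exists g, z; split=> // i Ei.
have -> : (z : witt K n) i - (x : witt K n) i
    = - wsum p (wtrunc i (wfrob p g)) (wtrunc i z) i.
  have /eqP g0i : g0 i == 0 by have := g0P i; rewrite Ei ltnn.
  rewrite zE [in X in _ - X - _ - _]ffunE ffunE g0i expr0n eqn0Ngt p_gt0 subr0.
  by rewrite addrAC subrr add0r.
rewrite valbndN //; apply: cross => [|j lt_ji]; first by rewrite Ei.
by apply: zbnd; rewrite -Ei.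
Qed.

(** In x = F(g) + z the part z is strictly smaller than fil_m requires. The bound on the p-th powers
    of the components of g divides their pole order by p, which puts g itself into fil_(m-1). *)
Lemma in_filF_pred m (x : W) : (0 < m)%N -> in_fil p v m x ->
  (forall i : 'I_n, exists g : K,
     valbnd D v (- (m * p ^ i)%:Z + 1) ((x : witt K n) i - g ^+ p)) ->
  in_filF p v m.-1 x.
Proof.
move=> m_gt0 fx good.
have [i _|g [z [-> gb zb _]]] := frobenius_split (k := n) fx; first exact: good.
rewrite addrC; apply: in_filF_cons => //.
  by apply: in_fil_pred => // i; apply: zb.
apply: in_fil_filF => // i; have := gb i (ltn_ord i).
rewrite PoszM -mulNr valbnd_scale // /valbnd expf_eq0 p_gt0 /=.
have [//|gi0] /= := eqVneq ((g : witt K n) i) 0; rewrite dvalX //.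
rewrite -mulr_natr natz mulrA; set X := _ * v _ => le_m.
have : - m%:Z < X.
  rewrite ltNge; apply/negP => le_X.
  have : - m%:Z <= - m%:Z * p%:Z.
    by apply: le_trans le_m _; apply: ler_wpM2r.
  rewrite mulNr lerN2 -PoszM lez_nat -{2}[m]muln1 leq_pmul2l //.
  by rewrite leqNgt prime_gt1.
by rewrite -lezD1; case: (m) m_gt0 => //= k _; rewrite intS opprD addrAC addNr add0r.
Qed.

(** With x = F(g) + z over K, one gets y = F(d) + z over K' for d = g - Y. Below k the terms z_i are
    small, as e(m-1) <= m', so the bound on y controls d_i^p and all carries by induction. At k it
    bounds d_k^p + z_k, and z_k is x_k up to a small error. *)
Lemma base_change_witness m (x : W) (k : 'I_n) :
  (0 < m)%N -> in_fil p v m x ->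
  (forall i : 'I_n, (i < k)%N -> exists g : K,
     valbnd D v (- (m * p ^ i)%:Z + 1) ((x : witt K n) i - g ^+ p)) ->
  forall (K' : fieldType) (iota : {rmorphism K -> K'}) (v' : K' -> int) (e : nat),
  is_dvaluation v' -> (forall y : K, y != 0 -> v' (iota y) = e%:Z * v y) ->
  forall (m' : nat) (y Y : wittg p_pr n K'), (e * m.-1 <= m')%N ->
  in_fil p v' m' y -> wmap iota x = y + wfrob p Y :> wittg p_pr n K' ->
  exists h : K', valbnd D v' (- (m' * p ^ k)%:Z) (iota ((x : witt K n) k) - h ^+ p).
Proof.
move=> m_gt0 fx good K' iota v' e v'_val v'E m' y Y le_m' /in_filP fy Exy.
have charK' : p \in [pchar K'] by rewrite (rmorph_pchar iota).
have [g [z [Ex _ zb zk]]] := frobenius_split fx good.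
have bnd' (i : 'I_n) t : valbnd D v (- (m * p ^ i)%:Z + 1) t ->
    valbnd D v' (- (m' * p ^ i)%:Z) (iota t).
  (* A vector with a single nonzero component transfers the bound through [in_fil_map]. *)
  move=> bt; pose a : W := [ffun j => if j == i then t else 0].
  have /(in_fil_map v'E)/(in_filW le_m')/in_filP/(_ i) : in_fil p v m.-1 a.
    apply: in_fil_pred => // j; rewrite ffunE; case: eqP => [->//|_].
    exact: valbnd0.
  by rewrite ffunE /a ffunE eqxx; apply.
pose z' : wittg p_pr n K' := wmap iota z.
pose d : wittg p_pr n K' := (wmap iota g : wittg p_pr n K') - Y.
have Ey : y = (wfrob p d : wittg p_pr n K') + z'.
  move: Exy; rewrite Ex wmapD wmap_frob.
  move=> /(congr1 (fun c : wittg p_pr n K' => c - (wfrob p Y : wittg p_pr n K'))).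
  rewrite /= addrK => <-; rewrite /d (wfrobD charK') (wfrobN charK').
  by rewrite addrAC.
have yE (i : 'I_n) : (d : witt K' n) i ^+ p + (z' : witt K' n) i =
    (y : witt K' n) i - wsum p (wtrunc i (wfrob p d)) (wtrunc i z') i.
  have := waddE (wfrob p d : wittg p_pr n K') z' i; rewrite -Ey => ->.
  by rewrite addrK; congr (_ + _); rewrite [RHS]ffunE.
have dk (i : 'I_n) : (i <= k)%N ->
    valbnd D v' (- (m' * p ^ i)%:Z) ((d : witt K' n) i ^+ p + (z' : witt K' n) i).
  elim/ltn_ind: {i}(i : nat) {-2}i (erefl (i : nat)) => l IH i Ei le_ik.
  have zj (j : 'I_n) : (j < i)%N ->
      valbnd D v' (- (m' * p ^ j)%:Z) ((z' : witt K' n) j).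
    by move=> lt_ji; rewrite ffunE; apply/bnd'/zb/(leq_trans lt_ji).
  rewrite yE; apply: valbndB => //; apply: wsum_trunc_bnd => // j lt_ji.
  rewrite ffunE -[_ ^+ p](addrK ((z' : witt K' n) j)).
  apply: valbndB (zj _ lt_ji) => //; apply: (IH j _ j erefl); first by rewrite -Ei.
  exact: leq_trans (ltnW lt_ji) le_ik.
exists (- (d : witt K' n) k).
have -> : iota ((x : witt K n) k) - (- (d : witt K' n) k) ^+ p
   = ((d : witt K' n) k ^+ p + (z' : witt K' n) k)
     - iota ((z : witt K n) k - (x : witt K n) k).
  rewrite -!(pFrobenius_autE charK') rmorphN opprK rmorphB opprB.
  rewrite [(z' : witt K' n) k]ffunE.
  by rewrite -addrA [iota (z k) + _]addrC subrK addrC.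
by apply: valbndB (dk k (leqnn k)) (bnd' _ _ (zk k erefl)).
Qed.

(** The first three conclusions make f extremal over K: its pole has exactly the order allowed by m,
    and no p-th power cancels its leading term. *)
Lemma swan_witness m (phi : W) : (0 < m)%N ->
  in_filF p v m phi -> ~ in_filF p v m.-1 phi ->
  exists (k : 'I_n) (f : K),
  [/\ f != 0, (p ^ (n.-1 - k))%:Z * v f = - m%:Z,
      forall g : K, ~~ valge v (f - g ^+ p) (v f + 1)
    & forall (K' : fieldType) (iota : {rmorphism K -> K'}) (v' : K' -> int) (e : nat),
      is_dvaluation v' -> (forall y : K, y != 0 -> v' (iota y) = e%:Z * v y) ->
      forall m' : nat, (e * m.-1 <= m')%N -> in_filF p v' m' (wmap iota phi) ->
      exists h : K', valbnd (p ^ (n.-1 - k)) v' (- m'%:Z) (iota f - h ^+ p)].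
Proof.
move=> m_gt0; move: phi; apply: (in_filF_ind charK) => [[]|x b fx fb IH nfx].
  exact: in_filF0.
(* If x lies in fil^F_(m-1), its image lies in fil^F_m' because e(m-1) <= m'. It can be subtracted
   over K', and the Frobenius in front of the remaining sum can be removed. *)
have [fx'|nfx'] := ClassicalEpsilon.excluded_middle_informative (in_filF p v m.-1 x).
  have [fb'|k [f [f0 vf nf Hf]]] := IH.
    apply: nfx; apply: in_filFD => //.
    by have := in_filF_cons charK (in_fil0 v p_pr _) fb'; rewrite add0r.
  exists k, f; split=> // K' iota v' e v'_val v'E m' le_m' fphi.
  have charK' : p \in [pchar K'] by rewrite (rmorph_pchar iota).
  apply: (Hf _ _ _ _ v'_val v'E _ le_m').
  apply: (in_filF_frob (p_pr := p_pr)) => //; rewrite -wmap_frob.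
  have := in_filFD (p_pr := p_pr) charK' v'_val fphi
    (in_filFN (p_pr := p_pr) charK' v'_val
      (in_filFW (p_pr := p_pr) charK' le_m' (in_filF_map charK v'E fx'))).
  by rewrite wmapD addrAC subrr add0r.
pose good (i : 'I_n) := Defs.decP (exists g : K,
     valbnd D v (- (m * p ^ i)%:Z + 1) ((x : witt K n) i - g ^+ p)).
have [allgood|] := boolP [forall i, good i].
  case: nfx'; apply: in_filF_pred => // i.
  exact/decPP/(forallP allgood).
case/forallPn=> i0 bad0; 
  case: (@arg_minnP _ i0 (fun i => ~~ good i) (fun i : 'I_n => i : nat) bad0)
    => k badk min_k.
have goodk (i : 'I_n) : (i < k)%N -> exists g : K,
     valbnd D v (- (m * p ^ i)%:Z + 1) ((x : witt K n) i - g ^+ p).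
  move=> lt_ik; apply/decPP; apply: contraTT lt_ik => badi.
  by rewrite -leqNgt; apply: min_k.
have nk g : ~~ valbnd D v (- (m * p ^ k)%:Z + 1) ((x : witt K n) k - g ^+ p).
  by apply: contra badk => H; apply/decPP; exists g.
pose f := (x : witt K n) k.
have fx0 := fx k; rewrite -/f in fx0.
(* Approximation by the p-th power of 0 also fails, so f is nonzero and attains the bound given by
   fil_m. *)
have := nk 0; rewrite expr0n eqn0Ngt p_gt0 subr0 /valbnd negb_or -/f => /andP[f0 nvf].
have vf : (p ^ (n.-1 - k))%:Z * v f = - m%:Z.
  move: fx0 nvf; rewrite (negbTE f0) /= => le_m; rewrite lezD1 -leNgt => le_v.
  apply/eqP; rewrite eq_le le_m andbT; move: le_v.
  rewrite (expn_split p k) !PoszM mulrAC -mulNr ler_pM2r //.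
  by rewrite ltz_nat expn_gt0 p_gt0.
exists k, f; split=> // [g|K' iota v' e v'_val v'E m' le_m' fphi].
  apply: contra (nk g) => /orP[|le_v]; rewrite /valbnd -/f; first by move=> ->.
  apply/orP; right; have -> : - (m * p ^ k)%:Z = D%:Z * v f.
    by rewrite (expn_split p k) !PoszM mulrAC vf mulNr.
  apply: le_trans (ler_wpM2l _ le_v) => //; rewrite mulrDr mulr1 lerD2l.
  by rewrite -[1]/(1%:Z) lez_nat expn_gt0 p_gt0.
have charK' : p \in [pchar K'] by rewrite (rmorph_pchar iota).
have [y [Y [fy _ Ey]]] := in_filF_inv (p_pr := p_pr) charK' fphi.
have [|h] := base_change_witness m_gt0 fx goodk v'_val v'E (y := y)
  (Y := Y - (wmap iota b : wittg p_pr n K')) le_m' fy.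
  rewrite (wfrobD charK') (wfrobN charK') addrA -Ey wmapD wmap_frob.
  by rewrite addrK.
by rewrite PoszM -mulNr valbnd_scale // => bh; exists h.
Qed.

End Witness.

(** * The perfect closure *)

Section PerfectClosure.
Variables (p : nat) (K : fieldType).
Hypothesis charK : p \in [pchar K].

Let p_pr : prime p := pcharf_prime charK.

Definition frobn (N : nat) (x : K) : K := x ^+ (p ^ N).

Lemma frobnD N x y : frobn N (x + y) = frobn N x + frobn N y.
Proof.
by apply: exprDn_pchar; rewrite pnatX pnatE ?charK.
Qed.
Lemma frobnM N x y : frobn N (x * y) = frobn N x * frobn N y. Proof. exact: exprMn. Qed.
Lemma frobn0 N : frobn N 0 = 0.
Proof. by rewrite /frobn expr0n eqn0Ngt expn_gt0 prime_gt0. Qed.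
Lemma frobn1 N : frobn N 1 = 1. Proof. exact: expr1n. Qed.
Lemma frobnN N x : frobn N (- x) = - frobn N x.
Proof. by apply/eqP; rewrite -addr_eq0 -frobnD addNr frobn0. Qed.
Lemma frobnV N x : frobn N x^-1 = (frobn N x)^-1. Proof. exact: exprVn. Qed.
Lemma frobnC N M x : frobn N (frobn M x) = frobn M (frobn N x).
Proof. by rewrite /frobn -!exprM mulnC. Qed.
Lemma frobn_add N M x : frobn (N + M) x = frobn N (frobn M x).
Proof. by rewrite /frobn -exprM -expnD addnC. Qed.
Lemma frobn_eq0 N x : (frobn N x == 0) = (x == 0).
Proof. by rewrite expf_eq0 expn_gt0 prime_gt0. Qed.
Lemma frobn_inj N : injective (frobn N).
Proof.
by move=> x y /eqP; rewrite -subr_eq0 -frobnN -frobnD frobn_eq0 subr_eq0 => /eqP.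
Qed.

(* The pair [(x, N)] stands for the [p^N]-th root of [x]. *)
Definition pcl_equivp (a b : K * nat) : bool := frobn b.2 a.1 == frobn a.2 b.1.

Lemma pcl_equivp_refl : reflexive pcl_equivp. Proof. by move=> a; apply: eqxx. Qed.
Lemma pcl_equivp_sym : ssrbool.symmetric pcl_equivp.
Proof. by move=> a b; apply: eq_sym. Qed.
Lemma pcl_equivp_trans : transitive pcl_equivp.
Proof.
move=> b a c /eqP ab /eqP bc; apply/eqP/(@frobn_inj b.2).
by rewrite frobnC ab frobnC bc frobnC.
Qed.
Canonical pcl_equivp_equiv :=
  EquivRel pcl_equivp pcl_equivp_refl pcl_equivp_sym pcl_equivp_trans.

Definition perfect_closure := {eq_quot pcl_equivp}.
HB.instance Definition _ : EqQuotient _ pcl_equivp perfect_closure :=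
  EqQuotient.on perfect_closure.
HB.instance Definition _ := Choice.on perfect_closure.

Lemma pcl_equivp_repr a :
  frobn a.2 (repr (\pi_perfect_closure a)).1 =
  frobn (repr (\pi_perfect_closure a)).2 a.1.
Proof.
have /eqP : repr (\pi_perfect_closure a) = a %[mod perfect_closure] by rewrite reprK.
by rewrite eqmodE => /eqP.
Qed.

Definition pcl_embed := lift_embed perfect_closure (fun x : K => (x, 0%N)).
Canonical pcl_embed_pi_morph := PiEmbed pcl_embed.

Definition pcl_addp (a b : K * nat) : K * nat :=
  (frobn b.2 a.1 + frobn a.2 b.1, (a.2 + b.2)%N).
Definition pcl_add := lift_op2 perfect_closure pcl_addp.
Lemma pcl_pi_add : {morph \pi : a b / pcl_addp a b >-> pcl_add a b}.
Proof.
move=> a b; unlock pcl_add; apply/eqmodP; rewrite /= /pcl_equivp /pcl_addp /=.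
set a' := repr _; set b' := repr _; apply/eqP.
have crossa : frobn (a.2 + b.2) (frobn b'.2 a'.1) = frobn (a'.2 + b'.2) (frobn b.2 a.1).
  rewrite -!frobn_add (_ : _ + _ = b.2 + b'.2 + a.2)%N; last by lia.
  by rewrite frobn_add pcl_equivp_repr -frobn_add; congr (frobn _ _); rewrite -/a'; lia.
have crossb : frobn (a.2 + b.2) (frobn a'.2 b'.1) = frobn (a'.2 + b'.2) (frobn a.2 b.1).
  rewrite -!frobn_add (_ : _ + _ = a.2 + a'.2 + b.2)%N; last by lia.
  by rewrite frobn_add pcl_equivp_repr -frobn_add; congr (frobn _ _); rewrite -/b'; lia.
by rewrite !frobnD crossa crossb.
Qed.
Canonical pcl_pi_add_morph := PiMorph2 pcl_pi_add.

Definition pcl_oppp (a : K * nat) : K * nat := (- a.1, a.2).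
Definition pcl_opp := lift_op1 perfect_closure pcl_oppp.
Lemma pcl_pi_opp : {morph \pi : a / pcl_oppp a >-> pcl_opp a}.
Proof.
move=> a; unlock pcl_opp; apply/eqmodP; rewrite /= /pcl_equivp /= !frobnN.
by rewrite pcl_equivp_repr.
Qed.
Canonical pcl_pi_opp_morph := PiMorph1 pcl_pi_opp.

Definition pcl_mulp (a b : K * nat) : K * nat :=
  (frobn b.2 a.1 * frobn a.2 b.1, (a.2 + b.2)%N).
Definition pcl_mul := lift_op2 perfect_closure pcl_mulp.
Lemma pcl_pi_mul : {morph \pi : a b / pcl_mulp a b >-> pcl_mul a b}.
Proof.
move=> a b; unlock pcl_mul; apply/eqmodP; rewrite /= /pcl_equivp /pcl_mulp /=.
set a' := repr _; set b' := repr _; apply/eqP.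
have crossa : frobn (a.2 + b.2) (frobn b'.2 a'.1) = frobn (a'.2 + b'.2) (frobn b.2 a.1).
  rewrite -!frobn_add (_ : _ + _ = b.2 + b'.2 + a.2)%N; last by lia.
  by rewrite frobn_add pcl_equivp_repr -frobn_add; congr (frobn _ _); rewrite -/a'; lia.
have crossb : frobn (a.2 + b.2) (frobn a'.2 b'.1) = frobn (a'.2 + b'.2) (frobn a.2 b.1).
  rewrite -!frobn_add (_ : _ + _ = a.2 + a'.2 + b.2)%N; last by lia.
  by rewrite frobn_add pcl_equivp_repr -frobn_add; congr (frobn _ _); rewrite -/b'; lia.
by rewrite !frobnM crossa crossb.
Qed.
Canonical pcl_pi_mul_morph := PiMorph2 pcl_pi_mul.

Definition pcl_invp (a : K * nat) : K * nat := (a.1^-1, a.2).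
Definition pcl_inv := lift_op1 perfect_closure pcl_invp.
Lemma pcl_pi_inv : {morph \pi : a / pcl_invp a >-> pcl_inv a}.
Proof.
move=> a; unlock pcl_inv; apply/eqmodP; rewrite /= /pcl_equivp /= !frobnV.
by rewrite pcl_equivp_repr.
Qed.
Canonical pcl_pi_inv_morph := PiMorph1 pcl_pi_inv.

Lemma pcl_addA : associative pcl_add.
Proof.
elim/quotW=> a; elim/quotW=> b; elim/quotW=> c; rewrite !piE /pcl_addp /=.
apply/eqmodP; rewrite /= /pcl_equivp /= addnA; apply/eqP; congr (frobn _ _).
by rewrite !frobnD -!frobn_add addrA; congr (_ + _ + _); congr (frobn _ _); lia.
Qed.

Lemma pcl_addC : commutative pcl_add.
Proof.
by elim/quotW=> a; elim/quotW=> b; rewrite !piE /pcl_addp addrC [(a.2 + _)%N]addnC.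
Qed.

Lemma pcl_add0 : left_id (pcl_embed 0) pcl_add.
Proof.
elim/quotW=> -[x N]; rewrite !piE /pcl_addp /= frobn0 add0r add0n.
by rewrite /frobn expn0 expr1.
Qed.

Lemma pcl_addN : left_inverse (pcl_embed 0) pcl_opp pcl_add.
Proof.
elim/quotW=> a; apply/eqP; rewrite piE /pcl_equivp /pcl_addp /=.
by rewrite frobnN addNr !frobn0.
Qed.

HB.instance Definition _ :=
  GRing.isZmodule.Build perfect_closure pcl_addA pcl_addC pcl_add0 pcl_addN.

Lemma pcl_mulA : associative pcl_mul.
Proof.
elim/quotW=> a; elim/quotW=> b; elim/quotW=> c; rewrite !piE /pcl_mulp /=.
apply/eqmodP; rewrite /= /pcl_equivp /= addnA; apply/eqP; congr (frobn _ _).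
by rewrite !frobnM -!frobn_add mulrA; congr (_ * _ * _); congr (frobn _ _); lia.
Qed.

Lemma pcl_mulC : commutative pcl_mul.
Proof.
by elim/quotW=> a; elim/quotW=> b; rewrite !piE /pcl_mulp mulrC [(a.2 + _)%N]addnC.
Qed.

Lemma pcl_mul1 : left_id (pcl_embed 1) pcl_mul.
Proof.
elim/quotW=> -[x N]; rewrite !piE /pcl_mulp /= frobn1 mul1r add0n.
by rewrite /frobn expn0 expr1.
Qed.

Lemma pcl_mulDl : left_distributive pcl_mul pcl_add.
Proof.
elim/quotW=> a; elim/quotW=> b; elim/quotW=> c; apply/eqP.
rewrite !piE /pcl_equivp /pcl_mulp /pcl_addp /=; apply/eqP.
rewrite !(frobnD, frobnM) mulrDl -!frobn_add.
by congr (_ * _ + _ * _); congr (frobn _ _); lia.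
Qed.

Lemma pcl_nonzero1 : pcl_embed 1 != pcl_embed 0 :> perfect_closure.
Proof. by rewrite piE /pcl_equivp /= frobn1 frobn0 oner_eq0. Qed.

HB.instance Definition _ :=
  GRing.Zmodule_isComNzRing.Build perfect_closure
    pcl_mulA pcl_mulC pcl_mul1 pcl_mulDl pcl_nonzero1.

Lemma pcl_mulV (a : perfect_closure) :
  a != pcl_embed 0 -> pcl_mul (pcl_inv a) a = pcl_embed 1.
Proof.
elim/quotW: a => a; rewrite !piE /pcl_equivp /= frobn0 frobn_eq0 => a0.
apply/eqmodP; rewrite /= /pcl_equivp /pcl_mulp /pcl_invp /= frobn1 frobnV.
by rewrite {1}/frobn expn0 expr1 mulVf // frobn_eq0.
Qed.

Lemma pcl_inv0 : pcl_inv (pcl_embed 0) = pcl_embed 0.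
Proof. by rewrite !piE /pcl_invp /= invr0. Qed.

HB.instance Definition _ :=
  GRing.ComNzRing_isField.Build perfect_closure pcl_mulV pcl_inv0.

Lemma pcl_embed_is_zmod : zmod_morphism (pcl_embed : K -> perfect_closure).
Proof.
move=> x y; apply/eqP.
rewrite -[pcl_embed x - _]/(pcl_add (pcl_embed x) (pcl_opp (pcl_embed y))).
by rewrite !piE /pcl_addp /pcl_oppp /= /frobn expn0 !expr1 addn0.
Qed.
HB.instance Definition _ :=
  GRing.isZmodMorphism.Build K perfect_closure pcl_embed pcl_embed_is_zmod.

Lemma pcl_embed_is_monoid : monoid_morphism (pcl_embed : K -> perfect_closure).
Proof.
split=> // x y; apply/eqP.
rewrite -[pcl_embed x * _]/(pcl_mul (pcl_embed x) (pcl_embed y)).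
by rewrite !piE /pcl_mulp /= /frobn expn0 !expr1 addn0.
Qed.
HB.instance Definition _ :=
  GRing.isMonoidMorphism.Build K perfect_closure pcl_embed pcl_embed_is_monoid.

Lemma pcl_pi_exp (a : K * nat) k :
  (\pi_perfect_closure a) ^+ k = \pi_perfect_closure (a.1 ^+ k, a.2).
Proof.
elim: k => [|k IH].
  by rewrite -[LHS]/(pcl_embed 1); apply/eqP; rewrite piE /pcl_equivp /= !frobn1.
rewrite exprS IH -[LHS]/(pcl_mul _ _); apply/eqP.
rewrite !piE /= /pcl_equivp /pcl_mulp /=.
by rewrite -frobnM -exprS -frobn_add.
Qed.

Lemma perfect_closure_radical (a : perfect_closure) :
  exists N x, a ^+ (p ^ N) = pcl_embed x.
Proof.
elim/quotW: a => a; exists a.2, a.1; rewrite pcl_pi_exp piE; apply/eqmodP.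
by rewrite /= /pcl_equivp /= /frobn expn0 expr1.
Qed.

Lemma perfect_closure_perfect (a : perfect_closure) : exists b, b ^+ p = a.
Proof.
elim/quotW: a => a; exists (\pi_perfect_closure (a.1, a.2.+1)).
rewrite pcl_pi_exp; apply/eqmodP.
by rewrite /= /pcl_equivp /= /frobn -exprM -expnS.
Qed.

End PerfectClosure.

(** * Valuations with rational values *)

(** On the perfect closure the value group is Z[1/p]; it is neither integral nor discrete, so no
    normalization is imposed. *)
Definition is_ratval (F : fieldType) (w : F -> rat) : Prop :=
  (forall x y, x != 0 -> y != 0 -> w (x * y) = w x + w y) /\
  (forall x y, x != 0 -> y != 0 -> x + y != 0 -> Num.min (w x) (w y) <= w (x + y)).

Section RationalValuation.
Variables (F : fieldType) (w : F -> rat).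
Hypothesis w_val : is_ratval w.

Lemma ratvalM x y : x != 0 -> y != 0 -> w (x * y) = w x + w y.
Proof. by case: w_val => wM _; apply: wM. Qed.

Lemma ratval1 : w 1 = 0.
Proof.
have := ratvalM (oner_neq0 F) (oner_neq0 F); rewrite mulr1 => /eqP.
by rewrite -subr_eq0 opprD addrA subrr add0r oppr_eq0 => /eqP.
Qed.

Lemma ratvalN x : w (- x) = w x.
Proof.
have [->|x0] := eqVneq x 0; first by rewrite oppr0.
have N1 : (-1 : F) != 0 by rewrite oppr_eq0 oner_eq0.
suff wN1 : w (-1) = 0 by rewrite -mulN1r ratvalM // wN1 add0r.
have /eqP := ratvalM N1 N1; rewrite mulrNN mulr1 ratval1 eq_sym.
by rewrite -mulr2n mulrn_eq0 /= => /eqP.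
Qed.

Lemma ratvalX x k : x != 0 -> w (x ^+ k) = w x *+ k.
Proof.
move=> x0; elim: k => [|k IH]; first by rewrite ratval1.
by rewrite exprS ratvalM ?expf_neq0 // IH mulrS.
Qed.

Definition ratval_gt (r : rat) (x : F) : Prop := x = 0 \/ r < w x.

Lemma ratval_gt_add r x y : ratval_gt r x -> ratval_gt r y -> ratval_gt r (x + y).
Proof.
case=> [->|rx]; first by rewrite add0r.
case=> [->|ry]; first by rewrite addr0; right.
have [->|x0] := eqVneq x 0; first by rewrite add0r; right.
have [->|y0] := eqVneq y 0; first by rewrite addr0; right.
have [->|xy0] := eqVneq (x + y) 0; first by left.
right; case: w_val => _ /(_ _ _ x0 y0 xy0); apply: lt_le_trans.
by rewrite lt_min rx ry.
Qed.

Lemma ratval_gtN r x : ratval_gt r x -> ratval_gt r (- x).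
Proof. by case=> [->|rx]; [left; rewrite oppr0 | right; rewrite ratvalN]. Qed.

(** The nonzero term of least valuation is strictly below the sum of the others and cannot cancel.
    This serves both to prove linear independence and to bound each term of an expansion. *)
Lemma ratval_dominant (I : finType) (t : I -> F) :
  (forall i j, t i != 0 -> t j != 0 -> w (t i) = w (t j) -> i = j) ->
  forall i, t i != 0 -> \sum_i t i != 0 /\ w (\sum_i t i) <= w (t i).
Proof.
move=> t_inj i ti0.
have [j tj0 min_j] := Order.TotalTheory.arg_minP (fun i => w (t i))
  (ti0 : (fun i => t i != 0) i).
have : ratval_gt (w (t j)) (\sum_(k | k != j) t k).
  apply: (big_ind (ratval_gt (w (t j)))) => [|x y|k ne_kj]; first by left.
    exact: ratval_gt_add.
  have [->|tk0] := eqVneq (t k) 0; [by left | right].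
  rewrite lt_neqAle min_j // andbT; apply: contra ne_kj => /eqP E.
  exact/eqP/t_inj.
move=> s_gt; rewrite (bigD1 j) //=; move: s_gt; set s := \sum_(k | _) _ => s_gt.
have no_gt : ~ ratval_gt (w (t j)) (t j + s).
  move=> gt_js; have := ratval_gt_add gt_js (ratval_gtN s_gt).
  by rewrite addrK => -[E|]; [rewrite E eqxx in tj0 | rewrite ltxx].
split; first by apply/eqP => E; apply: no_gt; left.
by apply: le_trans (min_j _ ti0); rewrite leNgt; apply/negP => H; apply: no_gt; right.
Qed.

End RationalValuation.

Section PerfectClosureValuation.
Variables (p : nat) (K F : fieldType) (j : {rmorphism K -> F}) (v : K -> int).
Hypothesis (p_pr : prime p) (charK : p \in [pchar K]) (v_val : is_dvaluation v).
Hypothesis radical : forall x : F, exists N y, x ^+ (p ^ N) = j y.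

Let p_gt0 : (0 < p)%N := prime_gt0 p_pr.

(** The value is forced: w(x) = v(y) / p^N when x^(p^N) = j(y). Two elements admit a common N, and
    raising to the power p^N is additive, so both axioms descend from K. *)
Lemma radical_ratval : exists2 w : F -> rat, is_ratval w &
  forall x, x != 0 -> w (j x) = (v x)%:~R.
Proof.
have pos N : (0 : rat) < (p ^ N)%:R by rewrite ltr0n expn_gt0 p_gt0.
have nz N : (p ^ N)%:R != 0 :> rat by rewrite gt_eqF.
pose P x (r : rat) := forall N y, x ^+ (p ^ N) = j y -> (v y)%:~R = r * (p ^ N)%:R.
have exP x : exists r, x != 0 -> P x r.
  have [->|x0] := eqVneq x 0; first by exists 0.
  have [N [y Ey]] := radical x; exists ((v y)%:~R / (p ^ N)%:R) => _ M z Ez.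
  have y0 : y != 0 by rewrite -(fmorph_eq0 j) -Ey expf_neq0.
  have z0 : z != 0 by rewrite -(fmorph_eq0 j) -Ez expf_neq0.
  have : y ^+ (p ^ M) = z ^+ (p ^ N).
    by apply: (fmorph_inj j); rewrite !rmorphXn -Ey -Ez /= -!exprM mulnC.
  move/(congr1 v); rewrite !dvalX // => E.
  have {}E : (v y)%:~R * (p ^ M)%:R = (v z)%:~R * (p ^ N)%:R :> rat.
    by move/(congr1 (intr : int -> rat)): E; rewrite !rmorphMn /= !mulr_natr.
  by apply: (mulIf (nz N)); rewrite -E mulrAC divfK.
have [w wP] : exists w : F -> rat, forall x, x != 0 -> P x (w x).
  exists (fun x =>
    sval (ClassicalEpsilon.constructive_indefinite_description _ (exP x))).
  by move=> x; case: ClassicalEpsilon.constructive_indefinite_description.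
have common x y : exists N x' y', x ^+ (p ^ N) = j x' /\ y ^+ (p ^ N) = j y'.
  have [N [x' Ex]] := radical x; have [M [y' Ey]] := radical y.
  exists (N + M)%N, (x' ^+ (p ^ M)), (y' ^+ (p ^ N)).
  by rewrite !rmorphXn /= -Ex -Ey -!exprM -!expnD addnC.
have lift x N x' : x ^+ (p ^ N) = j x' -> (x' == 0) = (x == 0).
  by move=> E; rewrite -(fmorph_eq0 j) -E expf_eq0 expn_gt0 p_gt0.
exists w; last first.
  move=> x x0; have jx0 : j x != 0 by rewrite fmorph_eq0.
  by rewrite (wP _ jx0 0%N x) ?mulr1.
split=> x y x0 y0.
  have [N [x' [y' [Ex Ey]]]] := common x y; apply: (mulIf (nz N)).
  rewrite -(wP _ (mulf_neq0 x0 y0) N (x' * y')); last by rewrite exprMn Ex Ey rmorphM.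
  rewrite mulrDl -(wP _ x0 _ _ Ex) -(wP _ y0 _ _ Ey) dvalM ?rmorphD //.
    by rewrite (lift _ _ _ Ex).
  by rewrite (lift _ _ _ Ey).
move=> xy0; have [N [x' [y' [Ex Ey]]]] := common x y.
have Exy : (x + y) ^+ (p ^ N) = j (x' + y').
  rewrite rmorphD -Ex -Ey; apply: exprDn_pchar.
  by rewrite pnatX pnatE // (rmorph_pchar j).
rewrite -(ler_pM2r (pos N)) -(wP _ xy0 _ _ Exy) minr_pMl ?(ltW (pos N)) //.
rewrite -(wP _ x0 _ _ Ex) -(wP _ y0 _ _ Ey).
have := dvalD v_val (x := x') (y := y'); rewrite (lift _ _ _ Ex) (lift _ _ _ Ey).
rewrite (lift _ _ _ Exy) => /(_ x0 y0 xy0).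
by rewrite !ge_min !ler_int.
Qed.

End PerfectClosureValuation.

(** * Discrete subfields of the perfect closure *)

Section SubfieldType.
Variables (F : fieldType) (S : divringClosed F).

Record subfield_of : Type := SubfieldOf { sfval : F; _ : sfval \in S }.

HB.instance Definition _ := [isSub for sfval].
HB.instance Definition _ := [Choice of subfield_of by <:].
HB.instance Definition _ := [SubChoice_isSubUnitRing of subfield_of by <:].
HB.instance Definition _ := [SubNzRing_isSubComNzRing of subfield_of by <:].
HB.instance Definition _ := [SubComUnitRing_isSubIntegralDomain of subfield_of by <:].
HB.instance Definition _ := [SubIntegralDomain_isSubField of subfield_of by <:].

End SubfieldType.

Section Adjoin.
Variables (F : fieldType) (p : nat) (S : divringClosed F) (g : F) (N : nat).
Hypothesis (p_pr : prime p) (charF : p \in [pchar F]).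
Local Notation E := (subfield_of S).
Local Notation q := (p ^ N)%N.
Hypothesis gqS : g ^+ q \in S.

Let q_gt0 : (0 < q)%N. Proof. by rewrite expn_gt0 prime_gt0. Qed.

Definition adjoin_eval (P : {poly E}) : F := (map_poly (val : E -> F) P).[g].

Definition adjoin : {pred F} := fun x => Defs.decP (exists P, x = adjoin_eval P).

Lemma adjoinP x : reflect (exists P, x = adjoin_eval P) (x \in adjoin).
Proof. exact: decPP. Qed.

Lemma sfvalP (x : E) : val x \in S. Proof. exact: (valP x). Qed.

Lemma adjoin_evalC (x : E) : adjoin_eval x%:P = val x.
Proof. by rewrite /adjoin_eval map_polyC hornerC. Qed.

Lemma adjoin_evalgen : adjoin_eval 'X = g.
Proof. by rewrite /adjoin_eval map_polyX hornerX. Qed.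

Lemma adjoin_evalD P Q : adjoin_eval (P + Q) = adjoin_eval P + adjoin_eval Q.
Proof. by rewrite /adjoin_eval rmorphD hornerD. Qed.

Lemma adjoin_evalM P Q : adjoin_eval (P * Q) = adjoin_eval P * adjoin_eval Q.
Proof. by rewrite /adjoin_eval rmorphM hornerM. Qed.

Lemma adjoin_evalX P k : adjoin_eval (P ^+ k) = adjoin_eval P ^+ k.
Proof. by rewrite /adjoin_eval rmorphXn horner_exp. Qed.

Lemma sub_adjoin : {subset S <= adjoin}.
Proof.
by move=> x xS; apply/adjoinP; exists (SubfieldOf xS)%:P; rewrite adjoin_evalC.
Qed.

Lemma gen_adjoin : g \in adjoin.
Proof. by apply/adjoinP; exists 'X; rewrite adjoin_evalgen. Qed.

Lemma adjoin_pow x : x \in adjoin -> x ^+ q \in S.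
Proof.
case/adjoinP=> P ->; elim/poly_ind: P => [|P d IH].
  by rewrite /adjoin_eval rmorph0 horner0 expr0n eqn0Ngt q_gt0 rpred0.
have -> : adjoin_eval (P * 'X + d%:P) = adjoin_eval P * g + val d.
  by rewrite adjoin_evalD adjoin_evalM adjoin_evalgen adjoin_evalC.
rewrite exprDn_pchar; last by rewrite pnatX pnatE ?charF.
rewrite exprMn; apply: rpredD; last exact/rpredX/sfvalP.
exact: rpredM.
Qed.

(** Polynomial expressions in g already form a field: the inverse of y is y^(q-1) / y^q, and y^q
    lies in S. *)
Lemma adjoin_closed : divring_closed adjoin.
Proof.
split.
- by apply: sub_adjoin; rewrite rpred1.
- move=> _ _ /adjoinP[P ->] /adjoinP[Q ->]; apply/adjoinP; exists (P - Q).
  by rewrite /adjoin_eval rmorphB hornerD hornerN.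
move=> x y /adjoinP[P Ex] yA.
have [->|y0] := eqVneq y 0; first by rewrite invr0 mulr0 sub_adjoin ?rpred0.
have yqS := adjoin_pow yA; have /adjoinP[Q Ey] := yA.
apply/adjoinP; exists (P * Q ^+ q.-1 * ((SubfieldOf yqS)^-1)%:P).
rewrite !adjoin_evalM adjoin_evalX adjoin_evalC -Ex -Ey fmorphV /= -mulrA.
have -> : y ^+ q = y * y ^+ q.-1 by rewrite -exprS prednK.
by congr (_ * _); rewrite invfM mulrCA mulfV ?mulr1 ?expf_neq0.
Qed.

(** Division by X^q - g^q. This polynomial may be reducible, so the coefficients need not be
    unique. *)
Lemma adjoin_repr x : x \in adjoin ->
  exists a : 'I_q -> E, x = \sum_(i < q) val (a i) * g ^+ i.
Proof.
case/adjoinP=> P ->; pose M : {poly E} := 'X^q - (SubfieldOf gqS)%:P.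
have sM : size M = q.+1 by rewrite size_XnsubC.
have M0 : M != 0 by rewrite -size_poly_eq0 sM.
exists (fun i => (P %% M)`_i).
have -> : adjoin_eval P = adjoin_eval (P %% M).
  rewrite {1}(divp_eq P M) adjoin_evalD adjoin_evalM {2}/adjoin_eval rmorphB hornerD.
  rewrite hornerN -!/(adjoin_eval _) adjoin_evalX adjoin_evalgen adjoin_evalC.
  by rewrite subrr mulr0 add0r.
rewrite /adjoin_eval (@horner_coef_wide _ q).
  by apply: eq_bigr => i _; rewrite coef_map.
apply: leq_trans (size_poly _ _) _.
by rewrite -ltnS -sM ltn_modp.
Qed.

End Adjoin.

Definition subfield_pack (F : fieldType) (S : {pred F}) (S_closed : divring_closed S) :
  divringClosed F := HB.pack S (GRing.isDivringClosed.Build F S S_closed).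

Section DiscreteSubfields.
Variables (F : fieldType) (p : nat) (w : F -> rat).
Hypothesis (p_pr : prime p) (charF : p \in [pchar F]) (w_val : is_ratval w).

Let p_gt0 : (0 < p)%N := prime_gt0 p_pr.

Definition discrete (e : nat) (S : {pred F}) : Prop :=
  forall x, x \in S -> x != 0 -> e%:R * w x \is a Num.int.

Lemma ratval_gt_sum (I : finType) (P : pred I) (t : I -> F) r :
  (forall i, P i -> ratval_gt w r (t i)) -> ratval_gt w r (\sum_(i | P i) t i).
Proof.
move=> tr; apply: (big_ind (ratval_gt w r)) => //; first by left.
by move=> x y; apply: ratval_gt_add.
Qed.

Lemma exprB_pchar (x y : F) : (x - y) ^+ p = x ^+ p - y ^+ p.
Proof. by rewrite -!(pFrobenius_autE charF) rmorphB. Qed.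

Lemma ratval_gt0_exp x : ratval_gt w 0 (x ^+ p) <-> ratval_gt w 0 x.
Proof.
have [->|x0] := eqVneq x 0; first by rewrite expr0n eqn0Ngt p_gt0.
rewrite /ratval_gt ratvalX // pmulrn_lgt0 //; split=> -[E|]; try by right.
  by move/eqP: E; rewrite expf_eq0 (negbTE x0) andbF.
by rewrite E eqxx in x0.
Qed.

Lemma int_coprime (r : rat) (i : nat) : coprime i p ->
  r *+ i \is a Num.int -> r *+ p \is a Num.int -> r \is a Num.int.
Proof.
move=> co_ip ri rp; have i_gt0 : (0 < i)%N.
  by case: i co_ip {ri} => //; rewrite /coprime gcd0n gtn_eqF ?prime_gt1.
case: (egcdnP p i_gt0) => u u' E _; move: E; rewrite (eqP co_ip) => E.
have -> : r = (r *+ i) *+ u - (r *+ p) *+ u'.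
  by rewrite -!mulrnA mulnC E mulrnDr addrAC [(p * _)%N]mulnC subrr add0r.
by apply: rpredB; apply: rpredMn.
Qed.

(* If [x] in [S(g)] had a new valuation, the powers of [x] would form a basis
   of [S(g)] over [S] with pairwise incongruent valuations, and expanding [g] in
   this basis would make [g] congruent to an element of [S]. *)
Lemma adjoin_discrete e (S : divringClosed F) (g : F) :
  (0 < e)%N -> discrete e S -> g != 0 -> w g = 0 -> g ^+ (p ^ 1) \in S ->
  (forall b, b \in S -> ~ ratval_gt w 0 (g ^+ p - b ^+ p)) ->
  discrete e (adjoin S g).
Proof.
move=> e_gt0 dS g0 wg gpS gS x xA x0.
apply/negPn/negP => nx; set r := e%:R * w x in nx.
(* As x^p lies in S, a nonintegral r has order exactly p modulo the integers, so the multiples r i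
   with 0 < i < p are nonintegral. *)
have rp : r *+ p \is a Num.int.
  have := adjoin_pow p_pr charF gpS xA => /dS; rewrite expf_neq0 // => /(_ isT).
  by rewrite expn1 ratvalX // mulrnAr.
have e0 : e%:R != 0 :> rat by rewrite pnatr_eq0 -lt0n.
have nri i : (0 < i < p)%N -> r *+ i \isn't a Num.int.
  case/andP=> i_gt0 lt_ip; apply: contra nx => ri; apply: int_coprime ri rp.
  by rewrite coprime_sym prime_coprime // gtnNdvd.
pose t (u : 'I_(p ^ 1) -> subfield_of S) i := val (u i) * x ^+ i.
have wt u i : t u i != 0 -> e%:R * w (t u i) - r *+ i \is a Num.int.
  rewrite mulf_eq0 negb_or => /andP[u0 xi0].
  by rewrite ratvalM // ratvalX // mulrDr mulrnAr addrK dS // (valP (u i)).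
have t_inj u i j : t u i != 0 -> t u j != 0 -> w (t u i) = w (t u j) -> i = j.
  move=> ti0 tj0 E; wlog lt_ij : i j ti0 tj0 E / (i < j)%N.
    move=> H; case: (ltngtP i j) => [lt_ij|lt_ji|/val_inj//]; first exact: H.
    by apply/esym/H.
  have := rpredB (wt _ _ ti0) (wt _ _ tj0); rewrite E opprB addrC addrA subrK.
  rewrite -mulrnBr 1?ltnW // => H.
  suff /negP : r *+ (j - i) \isn't a Num.int by []; apply: nri.
  rewrite subn_gt0 lt_ij /=; apply: leq_ltn_trans (leq_subr _ _) _.
  exact: (ltn_ord j).
have xiA i : x ^+ i \in adjoin S g.
  exact: (rpredX (S := subfield_pack (adjoin_closed p_pr charF gpS))).
have /fin_all_exists[a aP] (i : 'I_(p ^ 1)) :=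
  adjoin_repr p_pr gpS (xiA i).
pose M := \matrix_(i, j) a i j.
have comb (u : 'rV_(p ^ 1)) :
    \sum_i t (u 0) i = \sum_j val ((u *m M) 0 j) * g ^+ j.
  rewrite /t; under eq_bigr => i _ do rewrite aP mulr_sumr.
  rewrite exchange_big; apply: eq_bigr => j _; rewrite mxE rmorph_sum mulr_suml.
  by apply: eq_bigr => i _; rewrite mxE rmorphM mulrA.
(* A relation among the rows would be a vanishing combination of powers of x, whose nonzero terms
   have distinct valuations. *)
have M_unit : M \in unitmx.
  rewrite -row_free_unit; apply: inj_row_free => u uM0.
  apply/rowP => i; rewrite mxE; apply/eqP/negPn/negP => ui0.
  have ti0 : t (u 0) i != 0 by rewrite mulf_neq0 ?expf_neq0 // fmorph_eq0.
  have [/negP[]] := ratval_dominant w_val (@t_inj (u 0)) ti0.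
  by rewrite comb uM0 big1 // => j _; rewrite mxE rmorph0 mul0r.
have lt0q : (0 < p ^ 1)%N by rewrite expn1.
have lt1q : (1 < p ^ 1)%N by rewrite expn1 prime_gt1.
pose i0 := Ordinal lt0q; pose i1 := Ordinal lt1q.
pose b : 'rV_(p ^ 1) := delta_mx 0 i1 *m invmx M.
have gE : \sum_i t (b 0) i = g.
  rewrite comb /b mulmxKV // (bigD1 i1) //= mxE !eqxx rmorph1 mul1r expr1.
  rewrite big1 ?addr0 // => j ne_j1; rewrite mxE eqxx /= (negbTE ne_j1).
  by rewrite rmorph0 mul0r.
(* The constant coefficient of g in powers of x is the forbidden approximation: the other terms have
   valuation at least w(g) = 0 and nonintegral after scaling by e, hence positive. *)
apply: (gS _ (valP (b 0 i0))); rewrite -exprB_pchar; apply/ratval_gt0_exp.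
rewrite -{1}gE (bigD1 i0) //= /t expr0 mulr1 addrAC subrr add0r.
apply: ratval_gt_sum => i ne_i0; rewrite -/(t (b 0) i).
have [->|ti0] := eqVneq (t (b 0) i) 0; [by left | right].
have [_] := ratval_dominant w_val (@t_inj (b 0)) ti0; rewrite gE wg le_eqVlt.
case/predU1P=> // /esym w0; have := wt _ _ ti0.
rewrite w0 mulr0 sub0r rpredN => H.
suff /negP : r *+ i \isn't a Num.int by []; apply: nri.
by apply/andP; split; [rewrite lt0n | apply: (ltn_ord i)].
Qed.

(** The valuation of a term a_i u^i is i/p^N modulo the integers, so the terms never cancel. Only
    the constant term can have valuation 0, which means that adjoining u leaves the residue field
    unchanged. *)
Lemma adjoin_uniformizer N (S : divringClosed F) (u : F) :
  discrete 1 S -> u ^+ (p ^ N) \in S -> u != 0 -> w u = (p ^ N)%:R^-1 ->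
  discrete (p ^ N) (adjoin S u) /\
  forall x, x \in adjoin S u -> (x = 0 \/ 0 <= w x) ->
    exists2 b, b \in S & ratval_gt w 0 (x - b).
Proof.
move=> dS uS u0 wu; have q_gt0 : (0 < p ^ N)%N by rewrite expn_gt0 p_gt0.
have q0 : (p ^ N)%:R != 0 :> rat by rewrite pnatr_eq0 -lt0n.
split=> [x xA x0|x xA wx].
  have := adjoin_pow p_pr charF uS xA => /dS; rewrite expf_neq0 // => /(_ isT).
  by rewrite mul1r ratvalX // mulr_natl.
have [a Ex] := adjoin_repr p_pr uS xA.
pose t i := val (a i) * u ^+ i.
have wt i : t i != 0 -> w (t i) - i%:R / (p ^ N)%:R \is a Num.int.
  rewrite mulf_eq0 negb_or => /andP[a0 ui0].
  rewrite ratvalM // ratvalX // wu mulr_natl addrK -[w _]mul1r.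
  by apply: dS => //; apply: (valP (a i)).
have nint i : (0 < i < p ^ N)%N -> (i%:R / (p ^ N)%:R : rat) \isn't a Num.int.
  case/andP=> i_gt0 lt_iq; apply/negP => /intrP[z Ez].
  have z_gt0 : 0 < z by rewrite -(ltr_int rat) -Ez divr_gt0 ?ltr0n.
  have : z < 1 by rewrite -(ltr_int rat) -Ez ltr_pdivrMr ?ltr0n // mul1r ltr_nat.
  by lia.
have t_inj i j : t i != 0 -> t j != 0 -> w (t i) = w (t j) -> i = j.
  move=> ti0 tj0 E; wlog lt_ij : i j ti0 tj0 E / (i < j)%N.
    move=> H; case: (ltngtP i j) => [lt_ij|lt_ji|/val_inj//]; first exact: H.
    by apply/esym/H.
  have := rpredB (wt _ ti0) (wt _ tj0); rewrite E opprB addrC addrA subrK.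
  rewrite -mulrBl -natrB 1?ltnW // => H.
  suff /negP : ((j - i)%:R / (p ^ N)%:R : rat) \isn't a Num.int by []; apply: nint.
  by rewrite subn_gt0 lt_ij /=; apply: leq_ltn_trans (leq_subr _ _) _.
pose i0 := Ordinal q_gt0.
exists (val (a i0)); first exact: (valP (a i0)).
rewrite Ex (bigD1 i0) //= expr0 mulr1 addrAC subrr add0r.
apply: ratval_gt_sum => i ne_i0; rewrite -/(t i).
have [->|ti0] := eqVneq (t i) 0; [by left | right].
have [] := ratval_dominant w_val t_inj ti0; rewrite -Ex => x0 le_w.
have {wx} wx : 0 <= w x by case: wx => [E|//]; rewrite E eqxx in x0.
have := le_trans wx le_w; rewrite le_eqVlt => /predU1P[/esym w0|//].
have := wt _ ti0; rewrite w0 sub0r rpredN => H.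
suff /negP : (i%:R / (p ^ N)%:R : rat) \isn't a Num.int by []; apply: nint.
by rewrite lt0n ltn_ord andbT.
Qed.

End DiscreteSubfields.

Lemma maximal_discrete (F : fieldType) (w : F -> rat) (e : nat) (S0 : {pred F}) :
  divring_closed S0 -> discrete w e S0 ->
  exists S : {pred F},
  [/\ divring_closed S, discrete w e S, {subset S0 <= S}
    & forall S' : {pred F}, divring_closed S' -> discrete w e S' ->
      {subset S <= S'} -> {subset S' <= S}].
Proof.
move=> cS0 dS0.
(* Adjoining S0 to every set makes the empty chain harmless in Zorn's lemma: its union then stands
   for S0 itself. *)
pose U (A : F -> Prop) : {pred F} := fun x => Defs.decP (A x \/ x \in S0).
have UP A x : reflect (A x \/ x \in S0) (x \in U A) by apply: decPP.
pose P (A : classical_sets.set F) := divring_closed (U A) /\ discrete w e (U A).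
have [A [[cA dA] maxA]] : exists A, P A /\ forall B, classical_sets.proper A B -> ~ P B.
  apply: classical_sets.Zorn_bigcup => C PC totC.
  set V := classical_sets.bigcup _ _.
  have sub B : C B -> {subset U B <= U V}.
    by move=> CB x /UP[Bx|x0]; apply/UP; [left; exists B | right].
  have two x y : x \in U V -> y \in U V ->
      (exists2 B, C B & x \in U B /\ y \in U B) \/ (x \in S0 /\ y \in S0).
    move=> /UP[[B CB Bx]|x0] /UP[[B' CB' By]|y0]; last by right.
    - left; case: (totC _ _ CB CB') => BB'.
        by exists B' => //; split; apply/UP; left=> //; apply: BB'.
      by exists B => //; split; apply/UP; left=> //; apply: BB'.
    - by left; exists B => //; split; apply/UP; [left | right].
    - by left; exists B' => //; split; apply/UP; [right | left].
  split; last first.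
    move=> x xV; have [[B CB [xB _]]|[x0 _]] := two _ _ xV xV; last exact: dS0.
    by case: (PC _ CB) => _; apply.
  case: (cS0) => S01 S0B S0D; split.
  - by apply/UP; right.
  - move=> x y xV yV; have [[B CB [xB yB]]|[x0 y0]] := two _ _ xV yV.
      by apply: (sub _ CB); case: (PC _ CB) => -[_ cB _] _; apply: cB.
    by apply/UP; right; apply: S0B.
  - move=> x y xV yV; have [[B CB [xB yB]]|[x0 y0]] := two _ _ xV yV.
      by apply: (sub _ CB); case: (PC _ CB) => -[_ _ cB] _; apply: cB.
    by apply/UP; right; apply: S0D.
exists (U A); split=> // [x x0|S' cS' dS' sAS' x xS']; first by apply/UP; right.
apply/negPn/negP => nxA; apply: (maxA (fun y => y \in S')).
  split=> [y Ay|S'A]; first by apply/sAS'/UP; left.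
  by case/negP: nxA; apply/UP; left; apply: S'A.
have US' y : (y \in U (fun y => y \in S')) = (y \in S').
  apply/UP/idP => [[//|y0]|]; last by left.
  by apply/sAS'/UP; right.
split=> [|y]; last by rewrite US'; apply: dS'.
by case: cS' => S'1 S'B S'D; split=> [|y z|y z]; rewrite !US' //;
  [apply: S'B | apply: S'D].
Qed.

(** * Maximal discrete subfields as members of E_1 *)

Section ExtensionWithPerfectResidueField.
Variables (p : nat) (K F : fieldType) (j : {rmorphism K -> F}).
Variables (v : K -> int) (w : F -> rat).
Hypothesis (p_pr : prime p) (charK : p \in [pchar K]) (v_val : is_dvaluation v).
Hypothesis (w_val : is_ratval w) (wj : forall x, x != 0 -> w (j x) = (v x)%:~R).
Hypothesis F_perfect : forall x : F, exists y, y ^+ p = x.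

Let charF : p \in [pchar F]. Proof. by rewrite (rmorph_pchar j). Qed.

(** The element tau of valuation 1/e makes v' = e w normalized. The embedding of K' into F is kept
    so that further elements of S0 and their valuations can be handled in F. *)
Lemma E1_extension (e : nat) (S0 : {pred F}) (tau : F) :
  (0 < e)%N -> divring_closed S0 -> discrete w e S0 -> (forall x, j x \in S0) ->
  tau \in S0 -> tau != 0 -> e%:R * w tau = 1 ->
  exists (K' : fieldType) (iota : {rmorphism K -> K'}) (v' : K' -> int)
         (i : {rmorphism K' -> F}),
  [/\ in_E1 p v iota v', forall x, x != 0 -> v' (iota x) = e%:Z * v x,
      forall s, s \in S0 -> exists y, i y = s,
      forall x, i (iota x) = j x
    & forall y, y != 0 -> (v' y)%:~R = e%:R * w (i y)].
Proof.
move=> e_gt0 cS0 dS0 jS0 tauS0 tau0 wtau.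
have [S [cS dS sS0S maxS]] := maximal_discrete cS0 dS0.
pose Sc : divringClosed F := subfield_pack cS.
pose K' : fieldType := subfield_of Sc.
have jS x : j x \in Sc by apply: sS0S.
pose f (x : K) : K' := SubfieldOf (jS x).
have f_zmod : zmod_morphism f.
  by move=> x y; apply: val_inj; rewrite rmorphB /= rmorphB.
have f_mon : monoid_morphism f.
  split; first by apply: val_inj; rewrite rmorph1 /= rmorph1.
  by move=> x y; apply: val_inj; rewrite rmorphM /= rmorphM.
pose iota : {rmorphism K -> K'} := HB.pack f
  (GRing.isZmodMorphism.Build K K' f f_zmod)
  (GRing.isMonoidMorphism.Build K K' f f_mon).
pose i : {rmorphism K' -> F} := (val : K' -> F).
pose v' (y : K') : int := Num.floor (e%:R * w (i y)).
have e0 : e%:R != 0 :> rat by rewrite pnatr_eq0 -lt0n.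
have v'E y : y != 0 -> (v' y)%:~R = e%:R * w (i y).
  move=> y0; rewrite /v' floorK //; apply: dS; first exact: (valP y).
  by rewrite fmorph_eq0.
have v'iota x : x != 0 -> v' (iota x) = e%:Z * v x.
  move=> x0; apply: (@intr_inj rat); rewrite v'E ?fmorph_eq0 //.
  by rewrite wj // rmorphM.
have v'_val : is_dvaluation v'.
  split=> [x y x0 y0|x y x0 y0 xy0|].
  - apply: (@intr_inj rat); rewrite v'E ?mulf_neq0 // rmorphM ratvalM ?fmorph_eq0 //.
    by rewrite mulrDr rmorphD /= !v'E.
  - rewrite ge_min -!(ler_int rat) !v'E // !ler_pM2l ?ltr0n // -ge_min.
    by rewrite rmorphD; case: w_val => _; apply; rewrite -?rmorphD fmorph_eq0.
  - have tS : tau \in Sc by apply: sS0S.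
    exists (SubfieldOf tS); split; first by rewrite -(fmorph_eq0 i).
    by apply: (@intr_inj rat); rewrite v'E ?wtau // -(fmorph_eq0 i).
exists K', iota, v', i; split=> //; last first.
  by move=> s /sS0S sS; exists (SubfieldOf (sS : s \in Sc)).
split=> // [x|x|a va].
- rewrite /valge fmorph_eq0; have [//|x0] /= := eqVneq x 0.
  by rewrite v'iota // pmulr_rge0.
- rewrite /valge fmorph_eq0; have [//|x0] /= := eqVneq x 0.
  by rewrite v'iota // -!gtz0_ge1 pmulr_rgt0.
have valge1 y : ratval_gt w 0 (i y) -> valge v' y 1.
  rewrite /valge; have [//|y0] := eqVneq y 0; rewrite orFb; case=> [iy0|wy].
    by rewrite -(fmorph_eq0 i) iy0 eqxx in y0.
  by rewrite -gtz0_ge1 -(ltr_int rat) v'E // mulr_gt0 ?ltr0n.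
have vb1 y : valge v' y 0 = valbnd 1 v' 0 y by rewrite /valbnd mul1r.
(* Integrality of b is automatic, since b^p = a - (a - b^p). *)
suff [b bP] : exists b : K', ratval_gt w 0 (i (a - b ^+ p)).
  have vab := valge1 _ bP; exists b; split=> //.
  have : valbnd 1 v' 0 (b ^+ p).
    have -> : b ^+ p = a - (a - b ^+ p) by rewrite opprB addrC subrK.
    apply: valbndB => //; first by rewrite -vb1.
    rewrite -vb1; move: vab; rewrite /valge.
    by move=> /orP[->//|/(le_trans _)->//]; rewrite orbT.
  rewrite -vb1 /valge expf_eq0 prime_gt0 //=; have [//|b0] /= := eqVneq b 0.
  by rewrite dvalX // pmulrn_lge0 // prime_gt0.
have [//|nob] := ClassicalEpsilon.excluded_middle_informative
  (exists b : K', ratval_gt w 0 (i (a - b ^+ p))).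
have subpow b : i (a - b ^+ p) = i a - i b ^+ p by rewrite rmorphB rmorphXn.
have pow0 : (0 : F) ^+ p = 0 by rewrite expr0n eqn0Ngt prime_gt0.
have ia0 : i a != 0.
  by apply/eqP => ia; case: nob; exists 0; rewrite subpow ia rmorph0 pow0 subr0; left.
have wa : w (i a) = 0.
  move: va; rewrite /valge -(fmorph_eq0 i) (negbTE ia0) /=.
  rewrite -(ler_int rat) v'E; last first.
    by rewrite -(fmorph_eq0 i).
  rewrite pmulr_rge0 ?ltr0n // le_eqVlt => /predU1P[//|wa].
  by case: nob; exists 0; rewrite subpow rmorph0 pow0 subr0; right.
(* If a had no approximate p-th root in K', its root g in F could be adjoined without new
   valuations. Maximality then puts g into K', a contradiction. *)
have [g Eg] := F_perfect (i a).
have g0 : g != 0 by apply: contra ia0 => /eqP g0; rewrite -Eg g0 pow0.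
have wg : w g = 0.
  move: wa; rewrite -Eg ratvalX // => /eqP; rewrite mulrn_eq0 eqn0Ngt prime_gt0 //=.
  by move/eqP.
have gS : g ^+ (p ^ 1) \in Sc by rewrite expn1 Eg; apply: (valP a).
have dA : discrete w e (adjoin Sc g).
  apply: (adjoin_discrete p_pr charF w_val e_gt0 _ g0 wg gS) => // b bS gb.
  by case: nob; exists (SubfieldOf (bS : b \in Sc)); rewrite subpow -Eg.
have gSc : g \in S.
  apply: (maxS _ (adjoin_closed p_pr charF gS) dA); last exact: gen_adjoin.
  exact: (@sub_adjoin _ Sc g).
by case: nob; exists (SubfieldOf (gSc : g \in Sc)); rewrite subpow /= Eg subrr; left.
Qed.

End ExtensionWithPerfectResidueField.

(** * Extensions in E_1 *)

Section WildExtensions.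
Variables (p : nat) (K : fieldType) (v : K -> int).
Hypothesis (p_pr : prime p) (charK : p \in [pchar K]) (v_val : is_dvaluation v).

Let p_gt0 : (0 < p)%N := prime_gt0 p_pr.

Lemma dval_surj (z : int) : exists2 s : K, s != 0 & v s = z.
Proof.
case: (v_val) => _ _ [t [t0 vt]].
case: z => k; first by exists (t ^+ k); rewrite ?expf_neq0 // dvalX // vt natz.
exists (t ^+ k.+1)^-1; rewrite ?invr_neq0 ?expf_neq0 // dvalV ?expf_neq0 //.
by rewrite dvalX // vt natz NegzE.
Qed.

(** Valuations of p-th powers are divisible by p, so x and h^p have different valuations and v(x -
    h^p) is the smaller one. *)
Lemma dval_sub_exp (x h : K) : x != 0 -> ~~ (p%:Z %| v x)%Z ->
  x - h ^+ p != 0 /\ v (x - h ^+ p) <= v x.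
Proof.
move=> x0 nx; have [->|h0] := eqVneq h 0.
  by rewrite expr0n eqn0Ngt p_gt0 subr0.
have hp0 : h ^+ p != 0 by rewrite expf_neq0.
have vhp : v (h ^+ p) <> v x.
  by move=> E; case/negP: nx; rewrite -E dvalX // -mulr_natr natz dvdz_mull.
have d0 : x - h ^+ p != 0.
  by rewrite subr_eq0; apply/eqP => E; apply: vhp; rewrite -E.
split=> //; rewrite leNgt; apply/negP => lt_v; apply: vhp; apply/eqP.
rewrite eq_le; apply/andP; split.
  have := dvalD v_val d0 hp0; rewrite subrK => /(_ x0); rewrite ge_min.
  by rewrite leNgt lt_v.
have := dvalD v_val x0 (_ : - (x - h ^+ p) != 0); rewrite oppr_eq0 => /(_ d0).
rewrite opprB addrC subrK => /(_ hp0); apply: le_trans.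
by rewrite -opprB dvalN // le_min lexx ltW.
Qed.

Lemma perfect_closure_exists :
  exists (F : fieldType) (j : {rmorphism K -> F}) (w : F -> rat),
  [/\ is_ratval w, forall x, x != 0 -> w (j x) = (v x)%:~R
    & forall x : F, exists y, y ^+ p = x].
Proof.
pose F : fieldType := perfect_closure charK.
pose j : {rmorphism K -> F} := pcl_embed charK.
have [w w_val wj] := radical_ratval (j := j) p_pr charK v_val
  (@perfect_closure_radical p K charK).
exists F, j, w; split=> //.
exact: perfect_closure_perfect.
Qed.

Section InPerfectClosure.
Variables (F : fieldType) (j : {rmorphism K -> F}) (w : F -> rat).
Hypothesis (w_val : is_ratval w) (wj : forall x, x != 0 -> w (j x) = (v x)%:~R).
Hypothesis F_perfect : forall x : F, exists y, y ^+ p = x.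

Let charF : p \in [pchar F]. Proof. by rewrite (rmorph_pchar j). Qed.

Definition image : {pred F} := fun y => Defs.decP (exists x, y = j x).

Lemma imageP y : reflect (exists x, y = j x) (y \in image).
Proof. exact: decPP. Qed.

Lemma mem_image x : j x \in image. Proof. by apply/imageP; exists x. Qed.

Lemma image_closed : divring_closed image.
Proof.
split=> [|_ _ /imageP[x ->] /imageP[y ->]|_ _ /imageP[x ->] /imageP[y ->]].
- by rewrite -(rmorph1 j) mem_image.
- by rewrite -rmorphB mem_image.
- by rewrite -fmorph_div mem_image.
Qed.

Lemma image_discrete : discrete w 1 image.
Proof.
move=> _ /imageP[x ->]; rewrite fmorph_eq0 => x0.
by rewrite mul1r wj // intr_int.
Qed.

Lemma ratval_gt0_image x : ratval_gt w 0 (j x) -> valge v x 1.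
Proof.
rewrite /valge; have [//|x0] := eqVneq x 0; case=> [jx0|].
  by rewrite -(fmorph_eq0 j) jx0 eqxx in x0.
by rewrite wj // ltr0z gtz0_ge1.
Qed.

Lemma perfect_root N (x : F) : exists y, y ^+ (p ^ N) = x.
Proof.
elim: N => [|N [y Ey]]; first by exists x.
by have [z Ez] := F_perfect y; exists z; rewrite expnS exprM Ez.
Qed.

(** Besides the case where p does not divide v(f), this provides a member of E_1, hence the
    nonnegativity of every upper bound when s_K vanishes. *)
Lemma E1_unramified :
  exists (K' : fieldType) (iota : {rmorphism K -> K'}) (v' : K' -> int),
  in_E1 p v iota v' /\ (forall x, x != 0 -> v' (iota x) = 1%N%:Z * v x).
Proof.
have [t t0 vt] := dval_surj 1.
have [||K' [iota [v' [_ [E1 v'E _ _ _]]]]] := E1_extension p_pr charK w_val wj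
  F_perfect (tau := j t) (ltnSn 0) image_closed image_discrete mem_image (mem_image t).
- by rewrite fmorph_eq0.
- by rewrite mul1r wj // vt.
by exists K', iota, v'.
Qed.

Lemma E1_wild (B : nat) (f : K) : f != 0 -> (p%:Z %| v f)%Z ->
  (forall g : K, ~~ valge v (f - g ^+ p) (v f + 1)) ->
  exists (K' : fieldType) (iota : {rmorphism K -> K'}) (v' : K' -> int) (e : nat),
  [/\ in_E1 p v iota v', forall x, x != 0 -> v' (iota x) = e%:Z * v x, (B < e)%N
    & exists g r : K',
      [/\ iota f = g ^+ p + r, r != 0, ~~ (p%:Z %| v' r)%Z & v' r = e%:Z * v f + 1]].
Proof.
move=> f0 /dvdzP[k vf] nf.
have [t t0 vt] := dval_surj 1; have [s s0 vs] := dval_surj k.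
have sp0 : s ^+ p != 0 by rewrite expf_neq0.
have vsp : v (s ^+ p) = v f by rewrite dvalX // vs vf -mulr_natr natz.
(* Dividing by a p-th power of valuation v(f) leaves a unit whose residue is not a p-th power; this
   is [na] below. *)
pose a := f / s ^+ p; have a0 : a != 0 by rewrite mulf_neq0 ?invr_neq0.
have fE : f = a * s ^+ p by rewrite divfK.
have va : v a = 0 by rewrite dvalM ?invr_neq0 // dvalV // vsp subrr.
have na y : ~~ valge v (a - y ^+ p) 1.
  have E : f - (y * s) ^+ p = (a - y ^+ p) * s ^+ p by rewrite exprMn mulrBl -fE.
  apply: contra (nf (y * s)); rewrite E /valge mulf_eq0 (negbTE sp0) orbF.
  have [//|d0] /= := eqVneq (a - y ^+ p) 0.
  by rewrite dvalM // vsp (addrC (v f) 1) lerD2r.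
have [u Eu] := perfect_root B (j t).
pose e := (p ^ B)%N; have e_gt0 : (0 < e)%N by rewrite expn_gt0 p_gt0.
have e0 : e%:R != 0 :> rat by rewrite pnatr_eq0 -lt0n.
have u0 : u != 0.
  apply: contraNneq t0 => u0; rewrite -(fmorph_eq0 j) -Eu u0 expr0n.
  by rewrite eqn0Ngt e_gt0.
have wu : w u = e%:R^-1.
  have : w (u ^+ e) = 1 by rewrite Eu wj // vt.
  by rewrite ratvalX // => H; apply: (mulIf e0); rewrite mulVf // mulr_natr.
have wu_gt0 : ratval_gt w 0 u by right; rewrite wu invr_gt0 ltr0n.
pose S0 : divringClosed F := subfield_pack image_closed.
have uS0 : u ^+ (p ^ B) \in S0 by rewrite Eu; apply: mem_image.
have [dS1 resS1] := adjoin_uniformizer p_pr charF w_val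
  (image_discrete : discrete w 1 S0) uS0 u0 wu.
pose S1 : divringClosed F := subfield_pack (adjoin_closed p_pr charF uS0).
have uS1 : u \in S1 by apply: gen_adjoin.
have jS1 x : j x \in S1 by apply: (@sub_adjoin _ S0 u); apply: mem_image.
have ja0 : j a != 0 by rewrite fmorph_eq0.
have wja : w (j a) = 0 by rewrite wj // va.
have [g Eg] := F_perfect (j a - u).
have nau : ~ ratval_gt w 0 (j a - u).
  move=> /(ratval_gt_add w_val)/(_ wu_gt0); rewrite subrK => -[E|].
    by rewrite E eqxx in ja0.
  by rewrite wja ltxx.
have au0 : j a - u != 0 by apply/eqP => E; apply: nau; left.
have wau : w (j a - u) = 0.
  apply/eqP; rewrite eq_le; apply/andP; split.
    by rewrite leNgt; apply/negP => H; apply: nau; right.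
  case: w_val => _ /(_ (j a) (- u)); rewrite oppr_eq0 ja0 u0 au0.
  move=> /(_ isT isT isT); apply: le_trans.
  by rewrite wja ratvalN // wu le_min lexx invr_ge0 ler0n.
have pow0 : (0 : F) ^+ p = 0 by rewrite expr0n eqn0Ngt p_gt0.
have g0 : g != 0 by apply: contra au0 => /eqP g0; rewrite -Eg g0 pow0.
have wg : w g = 0.
  move: wau; rewrite -Eg ratvalX // => /eqP; rewrite mulrn_eq0 eqn0Ngt p_gt0 /=.
  by move/eqP.
have gS1 : g ^+ (p ^ 1) \in S1 by rewrite expn1 Eg; apply: rpredB.
(* The field S1 has the residue field of K, so b may be replaced by some y in K. Since u has
   positive valuation, a would then be congruent to y^p. *)
have ngb b : b \in S1 -> ~ ratval_gt w 0 (g ^+ p - b ^+ p).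
  move=> bS1 gb.
  (* Were w(b) negative, b^p would be the unit g^p minus an element of positive valuation, which
     cannot have negative valuation. *)
  have wb : b = 0 \/ 0 <= w b.
    have [->|b0] := eqVneq b 0; [by left | right].
    rewrite leNgt; apply/negP => wb_lt0.
    have wbp : w (b ^+ p) < 0 by rewrite ratvalX // pmulrn_llt0.
    have H1 : ratval_gt w (w (b ^+ p)) (g ^+ p) by right; rewrite Eg wau.
    have H2 : ratval_gt w (w (b ^+ p)) (- (g ^+ p - b ^+ p)).
      apply: ratval_gtN => //; case: gb => [->|gb]; first by left.
      by right; apply: lt_trans gb.
    have := ratval_gt_add w_val H1 H2; rewrite opprB addrC subrK => -[/eqP|].
      by rewrite expf_eq0 (negbTE b0) andbF.
    by rewrite ltxx.
  have [_ /imageP[y ->] by_gt] := resS1 b bS1 wb.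
  case/negP: (na y); apply: ratval_gt0_image; rewrite rmorphB rmorphXn /=.
  have -> : j a - j y ^+ p = (g ^+ p - b ^+ p) + u + (b ^+ p - j y ^+ p).
    by rewrite Eg [X in _ = X + _]addrAC subrK addrA subrK.
  apply: ratval_gt_add => //; first exact: ratval_gt_add.
  by rewrite -(exprB_pchar charF); apply/ratval_gt0_exp.
have dS2 := adjoin_discrete p_pr charF w_val e_gt0
  (dS1 : discrete w e S1) g0 wg gS1 ngb.
have [x||||K' [iota [v' [i [E1 v'E surj iE v'w]]]]] :=
  E1_extension p_pr charK w_val wj F_perfect (tau := u) e_gt0
    (adjoin_closed p_pr charF gS1) dS2.
- by apply: (@sub_adjoin _ S1 g).
- by apply: (@sub_adjoin _ S1 g).
- by [].
- by rewrite wu mulfV.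
have [g' Eg'] := surj g (gen_adjoin S1 g).
pose u' := iota a - g' ^+ p.
have iu' : i u' = u.
  by rewrite /u' rmorphB rmorphXn /= Eg' iE Eg opprB addrC subrK.
have u'0 : u' != 0 by rewrite -(fmorph_eq0 i) iu'.
have vu' : v' u' = 1 by apply: (@intr_inj rat); rewrite v'w // iu' wu mulfV.
have v'_val : is_dvaluation v' by case: E1.
have is0 : iota (s ^+ p) != 0 by rewrite fmorph_eq0.
have vr : v' (u' * iota (s ^+ p)) = e%:Z * v f + 1.
  by rewrite dvalM // vu' v'E // vsp addrC.
exists K', iota, v', e; split=> //; first by rewrite ltn_expl ?prime_gt1.
exists (g' * iota s), (u' * iota (s ^+ p)); split=> //.
- by rewrite fE rmorphM /= exprMn -rmorphXn -mulrDl /u' addrC subrK.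
- by rewrite mulf_neq0.
rewrite vr vf mulrA rpredDl ?dvdz_mull ?dvdzz // dvdz1 /=.
by rewrite gtn_eqF ?prime_gt1.
Qed.

End InPerfectClosure.

End WildExtensions.

(* s_K(phi) = sup { e(K'/K)^{-1} s_{K'}(phi) | K' in E_1 }, stated as:   *)
(* s_K(phi) is an upper bound of that set and below every upper bound.   *)
(* The ramification index e is characterised by v'(iota x) = e v(x).    *)
Theorem theorem8p6 (p : nat) (K : fieldType) (v : K -> int) (n : nat)
    (phi : witt K n) :
  prime p -> p \in [pchar K] -> is_dvaluation v ->
  (forall (K' : fieldType) (iota : {rmorphism K -> K'}) (v' : K' -> int)
          (e : nat),
     in_E1 p v iota v' ->
     (forall x : K, x != 0 -> v' (iota x) = e%:Z * v x) ->
     ((swan p v' (wmap iota phi))%:R / e%:R <= (swan p v phi)%:R :> rat))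
  /\
  (forall r : rat,
     (forall (K' : fieldType) (iota : {rmorphism K -> K'}) (v' : K' -> int)
             (e : nat),
        in_E1 p v iota v' ->
        (forall x : K, x != 0 -> v' (iota x) = e%:Z * v x) ->
        (swan p v' (wmap iota phi))%:R / e%:R <= r) ->
     (swan p v phi)%:R <= r).
Proof.
move=> p_pr charK v_val.
have [fphi min_phi] := swanP v (p_pr := p_pr) charK phi.
split=> [K' iota v' e E1 v'E|r ub].
  have charK' : p \in [pchar K'] by rewrite (rmorph_pchar iota).
  have [_ min_phi'] := swanP v' (p_pr := p_pr) charK' (wmap iota phi).
  (* For e = 0 the quotient is 0 by the convention on inverses. *)
  have [->|e0] := eqVneq e 0%N; first by rewrite invr0 mulr0 ler0n.
  rewrite ler_pdivrMr ?ltr0n ?lt0n // -natrM ler_nat mulnC.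
  exact/min_phi'/(in_filF_map (p_pr := p_pr) charK v'E).
have [F [j [w [w_val wj F_perfect]]]] := perfect_closure_exists p_pr charK v_val.
have [K1 [iota1 [v1 [E11 v1E]]]] := E1_unramified p_pr charK v_val w_val wj F_perfect.
have [m0|m_gt0] := posnP (swan p v phi).
  by rewrite m0; apply: le_trans (ub _ _ _ _ E11 v1E); rewrite divr1 ler0n.
set m := swan p v phi in fphi min_phi m_gt0 *.
have nphi : ~ in_filF p v m.-1 phi by move/min_phi; rewrite leqNgt ltn_predL m_gt0.
have [k [f [f0 vf nf Hf]]] := swan_witness (p_pr := p_pr) charK v_val m_gt0 fphi nphi.
set P := (p ^ (n.-1 - k))%N in vf Hf.
have P_gt0 : (0 < P)%N by rewrite expn_gt0 prime_gt0.
(* Here c measures how much p-th powers can raise the valuation of f: 0 if p does not divide v(f), 1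
   otherwise. [swan_witness] requires m' >= e(m-1), hence a maximum in the proof; c P < e excludes
   that the maximum is e(m-1). *)
have key (K' : fieldType) (iota : {rmorphism K -> K'}) (v' : K' -> int) (e c : nat) :
    in_E1 p v iota v' -> (forall x, x != 0 -> v' (iota x) = e%:Z * v x) ->
    (c * P < e)%N ->
    (forall h, iota f - h ^+ p != 0 /\ v' (iota f - h ^+ p) <= e%:Z * v f + c%:Z) ->
    (e * m <= swan p v' (wmap iota phi) + c * P)%N.
  move=> E1 v'E lt_e Hh; have charK' : p \in [pchar K'] by rewrite (rmorph_pchar iota).
  have v'_val : is_dvaluation v' by case: E1.
  have [fphi' _] := swanP v' (p_pr := p_pr) charK' (wmap iota phi).
  set s' := swan _ _ _ in fphi' *.
  have := in_filFW (p_pr := p_pr) charK' (leq_maxl s' (e * m.-1)) fphi'.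
  case/(Hf _ _ _ _ v'_val v'E _ (leq_maxr _ _)) => h; have [d0 le_d] := Hh h.
  rewrite /valbnd (negbTE d0) /= => le_m'.
  have : - (maxn s' (e * m.-1))%:Z <= P%:Z * (e%:Z * v f + c%:Z).
    by apply: le_trans le_m' _; apply: ler_wpM2l.
  rewrite mulrDr mulrCA vf; lia.
have [pf|npf] := boolP (p%:Z %| v f)%Z; last first.
  have := key _ _ _ _ 0%N E11 v1E; rewrite mul0n addn0 mul1n => /(_ isT).
  have := ub _ _ _ _ E11 v1E; rewrite divr1 => le_r le_m.
  apply: le_trans le_r; rewrite ler_nat; apply: le_m => h.
  have v1_val : is_dvaluation v1 by case: E11.
  by rewrite addr0 -v1E //; apply: dval_sub_exp => //; rewrite ?fmorph_eq0 ?v1E ?mul1r.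
rewrite leNgt; apply/negP => lt_rm.
have d_gt0 : 0 < m%:R - r by rewrite subr_gt0.
(* Since e > B, both P < e, needed for [key], and P < e(m - r), contradicting e m <= r e + P. *)
pose B := (P + Num.bound (P%:R / (m%:R - r)))%N.
have [K' [iota [v' [e [E1 v'E lt_Be [g [r' [fE r0 nr vr]]]]]]]] :=
  E1_wild p_pr charK v_val w_val wj F_perfect B f0 pf nf.
have v'_val : is_dvaluation v' by case: E1.
have charK' : p \in [pchar K'] by rewrite (rmorph_pchar iota).
have lt_Pe : (1 * P < e)%N by rewrite mul1n; apply: leq_ltn_trans (leq_addr _ _) lt_Be.
have e_gt0 : (0 < e)%N by apply: leq_ltn_trans lt_Pe.
have := key _ _ _ _ 1%N E1 v'E lt_Pe; rewrite mul1n => /(_ _)-le_em.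
have {}le_em : (e * m <= swan p v' (wmap iota phi) + P)%N.
  apply: le_em => h; rewrite -vr.
  (* The p-th power g^p is absorbed into h^p, leaving r', whose valuation is prime to p. *)
  have -> : iota f - h ^+ p = r' - (h - g) ^+ p.
    rewrite fE (exprB_pchar charK') opprB addrCA addrA.
    by rewrite [g ^+ p + r']addrC -addrA addrC.
  exact: dval_sub_exp.
have := ub _ _ _ _ E1 v'E; rewrite ler_pdivrMr ?ltr0n // => le_r.
have : e%:R * m%:R <= r * e%:R + P%:R.
  by apply: le_trans (lerD le_r (lexx _)); rewrite -natrM -natrD ler_nat.
rewrite -lerBlDl [r * _]mulrC -mulrBr leNgt => /negP[].
have : P%:R / (m%:R - r) < e%:R.
  apply: lt_trans (archi_boundP _) _; first by rewrite divr_ge0 ?ler0n // ltW.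
  by rewrite ltr_nat; apply: leq_ltn_trans (leq_addl _ _) lt_Be.
by rewrite ltr_pdivrMr.
Qed.
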